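(* Let $d\ge1$ be an integer and $s\ge d$. There exists a constant $C=C(s,d)>0$ such that for every measuring function $h$, every integer $N\ge2$, every $P>0$ and every measure $\nu$ on $\mathbb{R}^d$ that is a linear combination of $N$ Dirac point masses, $$M_h(\mathcal{Z}^\ast(\nu,P))\le C\,N\,h\bigg(\Big(\frac{\|\nu\|}{PN}\Big)^{1/s}\bigg).$$
   Context: Measures here are not necessarily positive (coefficients may be complex); $\|\nu\|$ is the total variation of $\nu$. Riesz transforms: $K^s(x)=\frac{x}{|x|^{s+1}}$ for $x\in\mathbb{R}^d\setminus\{0\}$; for $\varepsilon>0$, $$R^s_{\nu,\varepsilon}(x)=\int_{|y-x|>\varepsilon}K^s(y-x)\,d\nu(y),\qquad R^s_{\nu,\ast}(x)=\sup_{\varepsilon>0}|R^s_{\nu,\varepsilon}(x)|,\qquad \mathcal{Z}^\ast(\nu,P)=\{x\in\mathbb{R}^d: R^s_{\nu,\ast}(x)>P\}.$$ A measuring function is a continuous strictly increasing function $h:[0,+\infty)\to[0,+\infty)$ with $h(0)=0$, $\lim_{r\to+\infty}h(r)=+\infty$, and $h(r)/r^d$ non-increasing. The Hausdorff content of $G\subset\mathbb{R}^d$ is $M_h(G)=\inf\sum_j h(r_j)$, the infimum over all at most countable coverings of $G$ by balls of radii $r_j$. *)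

(* Defs.v *)
From HB Require Import structures.
From mathcomp Require Import all_boot all_order all_algebra.
From mathcomp Require Import all_classical all_reals all_analysis.
From mathcomp Require Import complex.

Set Implicit Arguments.
Unset Strict Implicit.
Unset Printing Implicit Defensive.

Import Order.TTheory GRing.Theory Num.Theory.
Import numFieldNormedType.Exports.

Local Open Scope classical_set_scope.
Local Open Scope ring_scope.
Local Open Scope complex_scope.

(* The library norm on ['rV[R]_d] is the sup norm, hence the explicit Euclidean
   one. *)
Definition enorm (R : realType) (d : nat) (x : 'rV[R]_d) : R :=
  Num.sqrt (\sum_(i < d) x 0 i ^+ 2).

Definition ecball (R : realType) (d : nat) (c : 'rV[R]_d) (r : R) :
  set 'rV[R]_d := [set y | enorm (y - c) <= r].

(* Norm of C^d, in which the Riesz transform of a complex measure takes its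
   values. *)
Definition cnorm (R : realType) (d : nat) (z : 'rV[R[i]]_d) : R :=
  Num.sqrt (\sum_(k < d) ComplexField.Normc.normc (z 0 k) ^+ 2).

(* R^d with its Borel sigma-algebra; as a type this is ['rV[R]_d]. *)
Definition borelRV (R : realType) (d : nat) :=
  g_sigma_algebraType (@open 'rV[R]_d).

Section charge_integral.
Context (disp : measure_display) (T : measurableType disp) (R : realType).
Variable nu : {charge set T -> \bar R}.

Definition hahn_pos : set T := projT1 (cid (Hahn_decomposition nu)).

Definition hahn_neg : set T :=
  projT1 (cid (projT2 (cid (Hahn_decomposition nu)))).

Definition hahn_posneg : hahn_decomposition nu hahn_pos hahn_neg :=
  projT2 (cid (projT2 (cid (Hahn_decomposition nu)))).

(* The Jordan parts do not depend on the chosen Hahn decomposition. *)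
Definition charge_Rintegral (D : set T) (f : T -> R) : R :=
  Rintegral (jordan_pos hahn_posneg) D f
  - Rintegral (jordan_neg hahn_posneg) D f.

End charge_integral.

(* Charges are finite, so a complex measure is a pair of charges. *)
Record complex_measure (disp : measure_display) (T : measurableType disp)
    (R : realType) := ComplexMeasure {
  cmRe : {charge set T -> \bar R};
  cmIm : {charge set T -> \bar R} }.

Section complex_measure_theory.
Context (disp : measure_display) (T : measurableType disp) (R : realType).
Variable nu : complex_measure T R.

Definition cmval (A : set T) : R[i] :=
  fine (cmRe nu A) +i* fine (cmIm nu A).

Definition cmintegral (D : set T) (f : T -> R) : R[i] :=
  charge_Rintegral (cmRe nu) D f +i* charge_Rintegral (cmIm nu) D f.

(* Supremum of \sum_k |nu (F k)| over the countable measurable partitions F of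
   the whole space. *)
Definition cmvariation : \bar R :=
  ereal_sup [set (\sum_(0 <= k <oo)
                    (ComplexField.Normc.normc (cmval (F k)))%:E)%E
            | F in [set F : (set T)^nat |
                [/\ forall k, measurable (F k), trivIset setT F &
                    \bigcup_k F k = setT]]].

(* The points need not be distinct and the coefficients may vanish. *)
Definition dirac_combination (N : nat) : Prop :=
  exists (c : 'I_N -> R[i]) (a : 'I_N -> T), forall A : set T, measurable A ->
    cmval A = \sum_(j < N) c j * (fine (\d_(a j) A : \bar R))%:C.

End complex_measure_theory.

Section riesz.
Context (R : realType) (d : nat) (s : R).

Definition riesz_kernel (x : 'rV[R]_d) : 'rV[R]_d :=
  (enorm x `^ (s + 1))^-1 *: x.

Definition riesz_transform (nu : complex_measure (borelRV R d) R) (eps : R)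
    (x : 'rV[R]_d) : 'rV[R[i]]_d :=
  \row_(k < d) cmintegral nu [set y : 'rV[R]_d | eps < enorm (y - x)]
                 (fun y : 'rV[R]_d => riesz_kernel (y - x) 0 k).

Definition riesz_maximal (nu : complex_measure (borelRV R d) R)
    (x : 'rV[R]_d) : \bar R :=
  ereal_sup [set (cnorm (riesz_transform nu eps x))%:E
            | eps in [set eps : R | 0 < eps]].

Definition riesz_bad_set (nu : complex_measure (borelRV R d) R) (P : R) :
  set 'rV[R]_d := [set x | (P%:E < riesz_maximal nu x)%E].

End riesz.

(* Only the values of h on [0, +oo[ are constrained or used. *)
Record measuring_function (R : realType) (d : nat) (h : R -> R) : Prop := {
  mf_ge0 : forall r, 0 <= r -> 0 <= h r;
  mf_continuous : {within [set r | 0 <= r], continuous h};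
  mf_increasing : forall r1 r2, 0 <= r1 -> r1 < r2 -> h r1 < h r2;
  mf_0 : h 0 = 0;
  mf_infty : h r @[r --> +oo] --> +oo;
  mf_ratio : forall r1 r2, 0 < r1 -> r1 <= r2 ->
    h r2 / r2 ^+ d <= h r1 / r1 ^+ d }.

(* At most countable coverings are indexed by an arbitrary J : set nat. *)
Definition hausdorff_content (R : realType) (d : nat) (h : R -> R)
    (G : set 'rV[R]_d) : \bar R :=
  ereal_inf [set x : \bar R | exists (J : set nat) (c : nat -> 'rV[R]_d)
      (r : nat -> R),
    [/\ forall j, J j -> 0 < r j,
        G `<=` \bigcup_(j in J) ecball (c j) (r j) &
        x = (\esum_(j in J) (h (r j))%:E)%E]].

(* Main.v *)
Require Import Defs.
From HB Require Import structures.
From mathcomp Require Import all_boot all_order all_algebra.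
From mathcomp Require Import all_classical all_reals all_analysis.
From mathcomp Require Import complex.
From mathcomp Require Import measurable_realfun.
From mathcomp Require Import ring lra zify.

Import Order.TTheory GRing.Theory Num.Theory.
Import numFieldNormedType.Exports.

Set Implicit Arguments.
Unset Strict Implicit.
Unset Printing Implicit Defensive.

Local Open Scope ring_scope.

(** Put delta = (|nu| / (P N))^(1/s).  The bound holds because the bad set
    meets at most C N cells of the lattice delta Z^d: each cell lies in a ball
    of radius d delta, and h (d delta) <= d^d h delta since h(r)/r^d does not
    increase ([content_le_cells]).  Dilating by 1/delta and normalising the
    coefficients reduces everything to one counting statement
    ([card_bad_cells]): if N real point charges v_i have total mass V, at most
    C (N + V) unit cells contain a point where a coordinate of some truncated
    Riesz sum exceeds 1.  Cells close to a charge number at most C N, so only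
    the remaining ones matter.

    For s > d the kernel |x|^{-s} is summable over the lattice away from the
    origin, and Chebyshev's inequality concludes.

    For s = d the sum diverges logarithmically and the oddness of the kernel
    has to be used: after moving charges and points to the lattice, what is
    needed is the discrete weak type (1,1) inequality for the maximal smooth
    truncation of the Riesz kernel ([discrete_maximal_weak_type]).  It is
    proved on a finite abelian group with a doubling seminorm, so that every
    sum is finite; the lattice is reached by embedding a large box in a torus
    (Z/M)^d.  The kernel is cut into odd Lipschitz layers k_l living at scale
    4^l.
    - The layers are almost orthogonal, |k_i * k_l|_1 <= C 4^{-|i-l|}, since
      each has mean zero and the wider one is smooth at the narrower scale.
      The Cotlar-Stein lemma ([cotlar_stein]) bounds their sum on l^2.
    - The set Omega where averages of |f| exceed a small constant c is small by
      the maximal inequality ([maximal_weak_type]).  Spreading each mass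
      located at b over a ball of radius comparable with dist(b, Omega^c)
      gives a function g with |g| <= C c, and changes the transform off Omega
      by an error of l^1 norm at most C |f|_1 ([smear_bounded],
      [smear_error_sum]).
    - Every truncation of the operator is an average of the full operator plus
      a kernel of bounded l^1 norm ([error_kernel_l1norm]), which contributes
      little because |g| <= C c.  The averages are controlled by the maximal
      inequality applied to the square of the transform of g, whose sum the
      l^2 bound estimates by C c |f|_1.

    Finally, nu has to be read off the abstract definitions: the integral
    against the Jordan parts of a combination of point masses is the expected
    finite sum ([charge_Rintegral_atomic]), and once the masses at equal points
    are merged the sum of their moduli is at most the total variation
    ([sum_normc_merged_le]). *)

(** * Convolution on a finite abelian group *)
Section FiniteSums.
Variables (R : realFieldType) (I : finType).

(** Cauchy-Schwarz without square roots: the weighted forms used for Young's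
    inequality, for averages and for sums of operators are all instances. *)
Lemma sqr_sum_le (x a b : I -> R) :
    (forall i, 0 <= a i) -> (forall i, 0 <= b i) ->
    (forall i, x i ^+ 2 <= a i * b i) ->
  (\sum_i x i) ^+ 2 <= (\sum_i a i) * (\sum_i b i).
Proof.
move=> a0 b0 xab.
have dbl (f g : I -> R) : (\sum_i f i) * (\sum_i g i) =
    \sum_i \sum_j f i * g j.
  by rewrite mulr_suml; apply: eq_bigr => i _; rewrite mulr_sumr.
rewrite expr2 dbl -(ler_pM2l (_ : 0 < 2)) // !mulr_natl !mulr2n.
have -> : (\sum_i a i) * (\sum_i b i) + (\sum_i a i) * (\sum_i b i) =
    \sum_i \sum_j (a i * b j + a j * b i).
  rewrite dbl [X in _ + X]exchange_big /= -big_split; apply: eq_bigr => i _.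
  by rewrite -big_split.
rewrite -big_split; apply: ler_sum => i _; rewrite -big_split.
apply: ler_sum => j _ /=.
set s := a i * b j; set t := a j * b i.
have s0 : 0 <= s by rewrite mulr_ge0.
have t0 : 0 <= t by rewrite mulr_ge0.
have st : (x i * x j) ^+ 2 <= s * t.
  rewrite exprMn (_ : s * t = (a i * b i) * (a j * b j)); last by rewrite /s /t; ring.
  by apply: ler_pM => //; exact: sqr_ge0.
have [neg|pos] := ltP (x i * x j) 0; first by lra.
rewrite -(ler_sqr (x := x i * x j + _)) ?nnegrE; [|lra|lra].
have := sqr_ge0 (s - t); nra.
Qed.

End FiniteSums.

Section Convolution.
Variables (R : realFieldType) (G : finZmodType).
Implicit Types u v w g h : G -> R.

Definition convol u v : G -> R := fun x => \sum_y u y * v (x - y).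
Definition l1norm u : R := \sum_x `|u x|.
(** The square of the l^2 norm; keeping it squared avoids square roots. *)
Definition sqnorm u : R := \sum_x u x ^+ 2.

Lemma l1norm_ge0 u : 0 <= l1norm u.
Proof. by apply: sumr_ge0 => x _. Qed.

Lemma sqnorm_ge0 u : 0 <= sqnorm u.
Proof. by apply: sumr_ge0 => x _; exact: sqr_ge0. Qed.

Lemma sum_translate (F : G -> R) y : \sum_x F (x - y) = \sum_x F x.
Proof.
by rewrite (reindex_inj (addIr y)); apply: eq_bigr => x _; rewrite addrK.
Qed.

Lemma sum_reflect (F : G -> R) y : \sum_x F (y - x) = \sum_x F x.
Proof. by rewrite (reindex_inj (subrI y)); apply: eq_bigr => x _; rewrite subKr. Qed.

Lemma convolC u v : convol u v = convol v u.
Proof.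
apply/funext => x; rewrite /convol -(sum_reflect _ x); apply: eq_bigr => y _.
by rewrite subKr mulrC.
Qed.

Lemma convolA u v w : convol u (convol v w) = convol (convol u v) w.
Proof.
apply/funext => x; rewrite /convol.
under eq_bigr do rewrite mulr_sumr.
under [RHS]eq_bigr do rewrite mulr_suml.
rewrite [RHS]exchange_big /=; apply: eq_bigr => y _.
rewrite -[RHS](sum_translate _ (- y)); apply: eq_bigr => z _.
by rewrite opprK addrK mulrA opprD addrA addrAC.
Qed.

Lemma convol_suml (J : Type) (s : seq J) (P : pred J) (f : J -> G -> R) v :
  convol (fun x => \sum_(j <- s | P j) f j x) v =
  fun x => \sum_(j <- s | P j) convol (f j) v x.
Proof.
apply/funext => x; rewrite /convol.
under eq_bigr do rewrite mulr_suml.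
by rewrite exchange_big.
Qed.

Lemma convolZl c u v : convol (fun x => c * u x) v = fun x => c * convol u v x.
Proof.
by apply/funext => x; rewrite mulr_sumr; apply: eq_bigr => y _; rewrite mulrA.
Qed.

Lemma convolBl u u' v :
  convol (fun x => u x - u' x) v = fun x => convol u v x - convol u' v x.
Proof.
by apply/funext => x; rewrite -sumrB; apply: eq_bigr => y _; rewrite mulrBl.
Qed.

Lemma convolDl u u' v :
  convol (fun x => u x + u' x) v = fun x => convol u v x + convol u' v x.
Proof.
by apply/funext => x; rewrite -big_split; apply: eq_bigr => y _; rewrite mulrDl.
Qed.

Lemma l1norm_convol u v : l1norm (convol u v) <= l1norm u * l1norm v.
Proof.
rewrite /l1norm mulr_suml.
apply: (@le_trans _ _ (\sum_x \sum_y `|u y| * `|v (x - y)|)).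
  apply: ler_sum => x _; apply: le_trans (ler_norm_sum _ _ _) _.
  by apply: ler_sum => y _; rewrite normrM.
rewrite exchange_big /=; apply: ler_sum => y _.
by rewrite -mulr_sumr (sum_translate (fun x => `|v x|)).
Qed.

Lemma l1normZ c u : l1norm (fun x => c * u x) = `|c| * l1norm u.
Proof. by rewrite /l1norm mulr_sumr; apply: eq_bigr => x _; rewrite normrM. Qed.

Lemma l1normB u v : l1norm (fun x => u x - v x) <= l1norm u + l1norm v.
Proof. by rewrite /l1norm -big_split; apply: ler_sum => x _; exact: ler_normB. Qed.

Lemma l1norm_sum (J : Type) (s : seq J) (P : pred J) (f : J -> G -> R) :
  l1norm (fun x => \sum_(j <- s | P j) f j x) <= \sum_(j <- s | P j) l1norm (f j).
Proof.
by rewrite exchange_big; apply: ler_sum => x _; exact: ler_norm_sum.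
Qed.

Lemma convol_le_sup u g c x : (forall y, `|g y| <= c) ->
  `|convol u g x| <= l1norm u * c.
Proof.
move=> gc; apply: le_trans (ler_norm_sum _ _ _) _.
rewrite mulr_suml; apply: ler_sum => y _.
by rewrite normrM; exact: ler_wpM2l.
Qed.

Definition opbound u (X : R) :=
  forall g, sqnorm (convol u g) <= X ^+ 2 * sqnorm g.

(** Young's inequality, from Cauchy-Schwarz with weights |u y|. *)
Lemma opbound_l1norm u : opbound u (l1norm u).
Proof.
move=> g; apply: (@le_trans _ _
    (\sum_x l1norm u * \sum_y `|u y| * g (x - y) ^+ 2)).
  apply: ler_sum => x _; apply: sqr_sum_le => [y|y|y] //.
    by rewrite mulr_ge0 // sqr_ge0.
  by rewrite mulrA exprMn -expr2 real_normK ?num_real.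
rewrite -mulr_sumr expr2 -mulrA ler_wpM2l ?l1norm_ge0 //.
rewrite exchange_big mulr_suml; apply: ler_sum => y _.
by rewrite -mulr_sumr (sum_translate (fun x => g x ^+ 2)).
Qed.

Lemma opbound_le u X Y : 0 <= X -> X <= Y -> opbound u X -> opbound u Y.
Proof.
move=> X0 XY uX g; apply: le_trans (uX g) _; rewrite ler_wpM2r ?sqnorm_ge0 //.
by rewrite ler_sqr // nnegrE (le_trans X0).
Qed.

Lemma opboundZ c u X : opbound u X -> opbound (fun x => c * u x) (c * X).
Proof.
move=> uX g; rewrite convolZl.
have -> : sqnorm (fun x => c * convol u g x) = c ^+ 2 * sqnorm (convol u g).
  by rewrite /sqnorm mulr_sumr; apply: eq_bigr => x _; rewrite exprMn.
by rewrite exprMn -[leRHS]mulrA ler_wpM2l ?sqr_ge0.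
Qed.

(** The triangle inequality for operator norms: Cauchy-Schwarz with weights X j
    replaces Minkowski's inequality. *)
Lemma opbound_sum (J : finType) (f : J -> G -> R) (X : J -> R) :
    (forall j, 0 < X j) -> (forall j, opbound (f j) (X j)) ->
  opbound (fun x => \sum_j f j x) (\sum_j X j).
Proof.
move=> X0 fX g; rewrite convol_suml.
apply: (@le_trans _ _ (\sum_x (\sum_j X j) *
    \sum_j convol (f j) g x ^+ 2 / X j)).
  apply: ler_sum => x _; apply: sqr_sum_le => [j|j|j].
  - exact: ltW.
  - by rewrite divr_ge0 ?sqr_ge0 // ltW.
  - by rewrite mulrC divfK // gt_eqF.
rewrite -mulr_sumr expr2 -mulrA ler_wpM2l ?sumr_ge0 // => [j _|]; first exact: ltW.
rewrite exchange_big mulr_suml; apply: ler_sum => j _ /=.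
rewrite -mulr_suml ler_pdivrMr //.
by rewrite mulrAC -expr2; exact: fX.
Qed.

Definition parity (s : R) u := forall x, u (- x) = s * u x.

Lemma convol_adjoint s u g h : parity s u ->
  \sum_x convol u g x * h x = s * \sum_x g x * convol u h x.
Proof.
move=> us; rewrite mulr_sumr.
under eq_bigr => x do rewrite convolC mulr_suml.
rewrite exchange_big; apply: eq_bigr => y _ /=.
rewrite convolC mulrCA mulr_sumr [RHS]mulr_sumr; apply: eq_bigr => x _.
by rewrite -[x - y]opprB us; ring.
Qed.

Lemma parity_convol s t u v : parity s u -> parity t v ->
  parity (s * t) (convol u v).
Proof.
move=> us vt x; rewrite /convol mulr_sumr -(sum_reflect _ 0).
apply: eq_bigr => y _.
by rewrite sub0r us opprK addrC -[y - x]opprB vt; ring.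
Qed.

Lemma parity_sum s (J : Type) (r : seq J) (P : pred J) (f : J -> G -> R) :
  (forall j, P j -> parity s (f j)) ->
  parity s (fun x => \sum_(j <- r | P j) f j x).
Proof. by move=> fs x; rewrite mulr_sumr; apply: eq_bigr => j Pj; exact: fs. Qed.

(** Convolution by an even or odd kernel is self-adjoint up to sign, hence its
    norm is the square root of the norm of its square. *)
Lemma opbound_sqrt s u X : s ^+ 2 = 1 -> parity s u ->
  opbound (convol u u) (X ^+ 2) -> opbound u X.
Proof.
move=> s1 us uX g.
rewrite -ler_sqr ?nnegrE ?sqnorm_ge0 ?(mulr_ge0 (sqr_ge0 _)) ?sqnorm_ge0 //.
have -> : sqnorm (convol u g) = s * \sum_x g x * convol (convol u u) g x.
  by rewrite -convolA -(convol_adjoint _ _ us); apply: eq_bigr => x _; rewrite expr2.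
rewrite [leLHS]exprMn s1 mul1r.
apply: (@le_trans _ _ (sqnorm g * sqnorm (convol (convol u u) g))).
  by apply: sqr_sum_le => x; rewrite ?sqr_ge0 // exprMn.
by rewrite [leRHS]exprMn mulrC expr2 [leRHS]mulrA ler_wpM2r ?sqnorm_ge0 //; exact: uX.
Qed.

End Convolution.

(** * The Cotlar-Stein lemma *)
Section CotlarStein.
(** The index set of the family is itself a finite abelian group, so that the
    sum over pairs (i, l) is regrouped by the difference m = l - i with a plain
    change of variable. *)
Variables (R : archiRealFieldType) (G H : finZmodType) (a : H -> R).
Hypothesis a_gt0 : forall m, 0 < a m.

Let almost_orth (k : H -> G -> R) :=
  forall i l, l1norm (convol (k i) (k l)) <= a (l - i) ^+ 2.

(** [bounds X]: the constant X serves for every almost orthogonal family with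
    profile a.  Quantifying over families is what makes the bound improve
    itself. *)
Let bounds (X : R) := forall s (k : H -> G -> R), s ^+ 2 = 1 ->
  (forall i, parity s (k i)) -> almost_orth k ->
  opbound (fun x => \sum_i k i x) X.

Let B := \sum_m a m.

Let B_ge0 : 0 <= B. Proof. by apply: sumr_ge0 => m _; exact: ltW. Qed.

Let bounds_init : bounds (\sum_(i : H) a 0).
Proof.
move=> s k s1 ks ok; apply: opbound_sum => // i.
apply: (opbound_sqrt s1 (ks i)).
apply: opbound_le (l1norm_ge0 _) _ (opbound_l1norm _).
by have := ok i i; rewrite subrr.
Qed.

(** Square the sum: it is the sum over m of a m times the sum of the family
    U m, i |-> k i * k (i + m) / a m.  By commutativity a product of two members
    of U m can be paired in two ways, and the geometric mean of the two
    resulting bounds shows that U m is almost orthogonal with the same profile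
    a.  So the square is bounded by B X, and the sum by sqrt (B X), which is at
    most (B + X) / 2. *)
Let bounds_improve X : 0 < X -> bounds X -> bounds ((B + X) / 2).
Proof.
move=> X0 bX s k s1 ks ok; set u := fun x => _.
have us : parity s u by apply: parity_sum => i _.
apply: (opbound_sqrt s1 us).
pose U m i := fun x => (a m)^-1 * convol (k i) (k (i + m)) x.
have -> : convol u u = fun x => \sum_m (a m * \sum_i U m i x).
  rewrite convol_suml; apply/funext => x.
  under eq_bigr => i _ do rewrite convolC convol_suml.
  under [RHS]eq_bigr => m _ do rewrite mulr_sumr.
  rewrite exchange_big [RHS]exchange_big /=.
  rewrite exchange_big /=; apply: eq_bigr => i _.
  rewrite (reindex_inj (addrI i)); apply: eq_bigr => m _ /=.
  by rewrite /U mulVKf ?gt_eqF // convolC.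
apply: (@opbound_le _ _ _ (\sum_m a m * X)).
- by apply: sumr_ge0 => m _; rewrite mulr_ge0 // ltW.
- by rewrite -mulr_suml -/B; have := sqr_ge0 (B - X); nra.
apply: opbound_sum => m; first by rewrite mulr_gt0.
apply: opboundZ; apply: (bX 1); first by rewrite expr1n.
  move=> i x; rewrite /U; rewrite (parity_convol (ks i) (ks _)) -expr2 s1.
  by rewrite !mul1r.
move=> i l; rewrite /U convolZl l1normZ convolC convolZl l1normZ.
rewrite gtr0_norm ?invr_gt0 // mulrA -expr2 exprVn.
rewrite ler_pdivrMl ?exprn_gt0 // -exprMn.
set t := l1norm _.
have t0 : 0 <= t by exact: l1norm_ge0.
have ta : t <= a m ^+ 2 * a m ^+ 2.
  apply: le_trans (l1norm_convol _ _) _.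
  have := ok i (i + m); have := ok l (l + m).
  rewrite ![_ + m - _]addrAC !subrr !add0r => h1 h2.
  by apply: ler_pM => //; exact: l1norm_ge0.
have tb : t <= a (l - i) ^+ 2 * a (l - i) ^+ 2.
  rewrite /t convolC convolA -(convolA (k i)) [convol (k (i + m)) (k l)]convolC.
  rewrite (convolA (k i)) -convolA.
  apply: le_trans (l1norm_convol _ _) _.
  have h1 := ok i l; have := ok (i + m) (l + m).
  rewrite opprD addrACA subrr addr0 => h2.
  by apply: ler_pM => //; exact: l1norm_ge0.
rewrite -ler_sqr ?nnegrE ?sqr_ge0 //.
have /le_trans : t ^+ 2 <= (a m ^+ 2 * a m ^+ 2) * (a (l - i) ^+ 2 * a (l - i) ^+ 2).
  by rewrite expr2; apply: ler_pM.
by apply; rewrite le_eqVlt; apply/orP; left; apply/eqP; ring.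
Qed.

(** Iterating X |-> (B + X) / 2 from the trivial bound converges to B. *)
Theorem cotlar_stein s (k : H -> G -> R) : s ^+ 2 = 1 ->
  (forall i, parity s (k i)) ->
  (forall i l, l1norm (convol (k i) (k l)) <= a (l - i) ^+ 2) ->
  opbound (fun x => \sum_i k i x) (\sum_m a m).
Proof.
move=> s1 ks ok g; rewrite -/B.
have X0 : 0 < \sum_(i : H) a 0.
  rewrite (bigD1 (0 : H)) //= ltr_pwDl // sumr_ge0 // => i _; exact: ltW.
set X := \sum_(i : H) a 0 in X0.
have bn n : bounds (B + X / 2 ^+ n).
  elim: n => [|n IH].
    rewrite expr0 divr1 => s' k' s1' ks' ok'.
    apply: opbound_le (bounds_init s1' ks' ok'); first exact: ltW.
    by rewrite lerDr.
  have -> : B + X / 2 ^+ n.+1 = (B + (B + X / 2 ^+ n)) / 2.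
    by rewrite exprS; field; rewrite expf_eq0 pnatr_eq0 andbF. 
  by apply: bounds_improve => //; rewrite ltr_wpDl // divr_gt0 ?exprn_gt0.
set S := sqnorm g; have S0 : 0 <= S by exact: sqnorm_ge0.
apply/ler_addgt0Pr => e e0.
pose n := Num.bound ((X * (2 * B + X) * S) / e).
have hn : X * (2 * B + X) * S <= 2 ^+ n * e.
  rewrite -ler_pdivrMr //.
  have h : X * (2 * B + X) * S / e < n%:R.
    apply: archi_boundP; apply: divr_ge0; last exact: ltW.
    apply: mulr_ge0 => //; apply: mulr_ge0; first exact: ltW.
    by have := B_ge0; have := X0; lra.
  apply: ltW; apply: lt_le_trans h _.
  by rewrite -natrX ler_nat ltnW // ltn_expl.
apply: le_trans (bn n _ _ s1 ks ok g) _; rewrite -/S.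
have p0 : 0 < 2 ^+ n :> R by rewrite exprn_gt0.
have p1 : 1 <= 2 ^+ n :> R by rewrite exprn_ege1 // ler1n.
set y := X / 2 ^+ n.
have y0 : 0 <= y by rewrite divr_ge0 // ltW.
have yX : y <= X by rewrite ler_pdivrMr // ler_peMr // ltW.
have ye : y * (2 * B + X) * S <= e.
  by rewrite /y mulrAC -mulrA mulrAC ler_pdivrMr // [e * _]mulrC mulrA [X * S * _]mulrAC.
have : y * (y * S) <= y * (X * S) by rewrite ler_wpM2l // ler_wpM2r.
nra.
Qed.

End CotlarStein.

(** * Geometric sums *)
Section GeometricSums.
Variable R : realFieldType.

Lemma sum_expn_le (b m : nat) : (1 < b)%N ->
  (\sum_(0 <= l < m) b ^ l <= b ^ m)%N.
Proof.
move=> b1; elim: m => [|m IH]; first by rewrite big_geq.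
rewrite big_nat_recr //= expnS; apply: leq_trans (leq_add IH (leqnn _)) _.
by rewrite addnn -mul2n leq_mul2r b1 orbT.
Qed.

Lemma sum_exprV_le (b m J : nat) : (1 < b)%N ->
  \sum_(m <= l < J) ((b ^ l)%:R^-1 : R) <= 2 / (b ^ m)%:R.
Proof.
move=> b1; have p0 l : 0 < (b ^ l)%:R :> R by rewrite ltr0n expn_gt0; lia.
have [Jm|mJ] := leqP J m; first by rewrite big_geq // divr_ge0 // ltW.
suff : \sum_(m <= l < J) ((b ^ l)%:R^-1 : R) <= 2 / (b ^ m)%:R - 2 / (b ^ J)%:R.
  by move=> /le_trans; apply; rewrite gerBl divr_ge0 // ltW.
rewrite -(subnKC (ltnW mJ)); elim: (J - m)%N => [|k IH].
  by rewrite addn0 big_geq // subrr.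
rewrite addnS big_nat_recr ?leq_addr //=; apply: le_trans (lerD IH (lexx _)) _.
set q := (b ^ (m + k))%:R; rewrite expnS natrM invfM.
have : (b%:R : R)^-1 <= 2^-1 by rewrite lef_pV2 ?posrE ?ltr0n ?ler_nat //; lia.
have : 0 < q^-1 by rewrite invr_gt0 p0.
have := p0 (m + k)%N; rewrite -/q => q0.
set z := q^-1; move=> z0 hb; nra.
Qed.

(** With l0 the first admissible exponent, t / 4^l0 <= 4 and the terms decrease
    geometrically.  The induction carries along the bound 4/3 min(T J, 4) for
    the terms still to come. *)
Lemma sum_scaled_tail (t J : nat) :
  \sum_(0 <= l < J | (t <= 4 ^ l.+1)%N) (t%:R / (4 ^ l)%:R : R) <= 6.
Proof.
have p0 l : 0 < (4 ^ l)%:R :> R by rewrite ltr0n expn_gt0.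
pose T l : R := t%:R / (4 ^ l)%:R.
suff : \sum_(0 <= l < J | (t <= 4 ^ l.+1)%N) T l + 4 / 3 * Num.min (T J) 4 <= 16 / 3.
  have T0 : 0 <= Num.min (T J) 4 by rewrite le_min divr_ge0 ?ler0n ?ltW.
  by move: T0; set s := \sum_(_ <= _ < _ | _) _; lra.
elim: J => [|J IH].
  rewrite big_geq // add0r.
  by have : Num.min (T 0) 4 <= 4 by [rewrite ge_min lexx orbT]; lra.
have TS : T J.+1 = T J / 4 by rewrite /T expnS natrM invfM mulrCA mulrC.
have TJ : (T J <= 4) = (t <= 4 ^ J.+1)%N.
  by rewrite /T ler_pdivrMr // -natrM ler_nat -expnS.
rewrite big_mkcond big_nat_recr //= -big_mkcond /= -TJ TS.
move: IH; set s := \sum_(_ <= _ < _ | _) _; move: (T J) => x.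
rewrite /Num.min; case: (leP x 4) => hx; case: ltP => h1; case: ltP => h2; lra.
Qed.

End GeometricSums.

(** * Doubling groups and the maximal inequality *)
Section Doubling.
Variables (G : finZmodType) (n : G -> nat).
Hypothesis n0 : n 0 = 0%N.
Hypothesis nN : forall x, n (- x) = n x.
Hypothesis nD : forall x y, (n (x + y)%R <= n x + n y)%N.

Definition vol r := #|[set x | (n x <= r)%N]|.

Lemma n_distC x y : n (x - y) = n (y - x). Proof. by rewrite -nN opprB. Qed.

Lemma n_tri z x y : (n (x - y)%R <= n (x - z)%R + n (z - y)%R)%N.
Proof. by have := nD (x - z) (z - y); rewrite addrA subrK. Qed.

Lemma vol_gt0 r : (0 < vol r)%N.
Proof. by apply/card_gt0P; exists 0; rewrite inE n0. Qed.

Lemma vol_mono r s : (r <= s)%N -> (vol r <= vol s)%N.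
Proof.
by move=> rs; apply/subset_leq_card/fintype.subsetP => x; rewrite !inE => /leq_trans; apply.
Qed.

Lemma card_ball q r : #|[set x | (n (x - q)%R <= r)%N]| = vol r.
Proof.
rewrite /vol -(card_imset [set x | (n x <= r)%N] (addIr q)).
apply: eq_card => x; rewrite inE; apply/idP/imsetP => [h|[y]].
  by exists (x - q); rewrite ?inE ?subrK.
by rewrite inE => h ->; rewrite addrK.
Qed.

Variable D : nat.
(** The radius 2r + 1 instead of 2r makes the condition informative at r = 0. *)
Hypothesis doubling : forall r, (vol (r.*2.+1) <= D * vol r)%N.

Lemma D_gt0 : (0 < D)%N.
Proof.
case: (posnP D) => // D0; have := leq_trans (vol_gt0 _) (doubling 0).
by rewrite D0 mul0n.
Qed.

Lemma vol_quad r : (vol (4 * r) <= D ^ 2 * vol r)%N.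
Proof.
apply: (@leq_trans (D * vol r.*2.+1)); last first.
  by rewrite expnS expn1 -mulnA leq_mul2l doubling orbT.
by apply: leq_trans (doubling r.*2.+1); apply: vol_mono; lia.
Qed.

Variable R : archiRealFieldType.

(** Vitali's covering argument as an induction: a point q of S with the largest
    radius accounts for the points of S at distance at most 2 rho q + 1, whose
    number doubling bounds, by the mass of its own ball; the balls centred at
    the other points avoid that ball, so its mass can be removed. *)
Lemma maximal_weak_type (F : G -> R) (lam : R) (S : {set G}) (rho : G -> nat) :
    (forall x, 0 <= F x) -> 0 <= lam ->
    (forall q, q \in S ->
      lam * (vol (rho q))%:R <= \sum_(b | (n (b - q)%R <= rho q)%N) F b) ->
  lam * #|S|%:R <= D%:R * \sum_b F b.
Proof.
move=> F0 lam0 hS.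
suff H m (S' T : {set G}) : (#|S'| <= m)%N ->
    (forall q, q \in S' -> lam * (vol (rho q))%:R <=
      \sum_(b | (n (b - q)%R <= rho q)%N && (b \in T)) F b) ->
    lam * #|S'|%:R <= D%:R * \sum_(b in T) F b.
  have := H _ S [set: G] (leqnn _).
  rewrite (eq_bigl xpredT) => [|x]; last by rewrite inE.
  by apply=> q /hS; under [X in _ -> _ <= X]eq_bigl do rewrite inE andbT.
elim: m S' T => [|m IH] S' T.
  rewrite leqn0 cards_eq0 => /eqP -> _; rewrite cards0 mulr0.
  by rewrite mulr_ge0 ?sumr_ge0.
move=> cS hST; have [->|[q0 q0S]] := set_0Vmem S'.
  by rewrite cards0 mulr0 mulr_ge0 ?sumr_ge0.
pose q := [arg max_(i > q0 in S') rho i]%N.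
have [qS qmax] : q \in S' /\ forall i, i \in S' -> (rho i <= rho q)%N.
  by rewrite /q; case: arg_maxnP => // i.
pose near := [set x | (n (x - q)%R <= (rho q).*2.+1)%N].
pose ball := [set b | (n (b - q)%R <= rho q)%N].
have cnear : (#|S' :&: near| <= D * vol (rho q))%N.
  apply: leq_trans (doubling _); rewrite -(card_ball q).
  by apply/subset_leq_card/finset.subsetIr.
have cfar : (#|S' :\: near| <= m)%N.
  rewrite -ltnS; apply: leq_trans cS.
  rewrite -(cardsID near S') -[X in (X < _)%N]add0n ltn_add2r.
  by apply/card_gt0P; exists q; rewrite !inE qS subrr n0.
have far : lam * #|S' :\: near|%:R <= D%:R * \sum_(b in T :\: ball) F b.
  apply: IH => // x; rewrite !inE => /andP[xnear xS].
  have := hST _ xS; under eq_bigl => b.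
    have -> : (n (b - x)%R <= rho x)%N && (b \in T) =
        (n (b - x)%R <= rho x)%N && (b \in T :\: ball).
      rewrite !inE; case bx: (n (b - x)%R <= rho x)%N => //=.
      suff -> : (n (b - q)%R <= rho q)%N = false by [].
      apply/negP => bq; move/negP: xnear; apply.
      apply: leq_trans (n_tri b x q) _; rewrite (n_distC x b) leqW // -addnn.
      by rewrite leq_add // (leq_trans bx) // qmax.
    over.
  by [].
have nearle : lam * #|S' :&: near|%:R <= D%:R * \sum_(b in T :&: ball) F b.
  apply: (@le_trans _ _ (D%:R * (lam * (vol (rho q))%:R))).
    by rewrite mulrCA ler_wpM2l // -natrM ler_nat.
  rewrite ler_wpM2l //; apply: le_trans (hST _ qS) _.
  by rewrite le_eqVlt (eq_bigl (mem (T :&: ball))) ?eqxx // => b; rewrite !inE andbC.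
rewrite -(cardsID near S') natrD mulrDr.
apply: le_trans (lerD nearle far) _.
by rewrite -mulrDr [X in _ <= _ * X](big_setID ball) lexx.
Qed.

(** As u sums to zero, u * v is a combination of the differences
    v(. - y) - v with y in the support of u. *)
Lemma l1norm_convol_zerosum (u v : G -> R) (r : nat) (beta : R) :
    \sum_x u x = 0 -> (forall x, u x != 0 -> (n x <= r)%N) -> 0 <= beta ->
    (forall y, l1norm (fun x => v (x - y) - v x) <= beta * (n y)%:R) ->
  l1norm (convol u v) <= l1norm u * (beta * r%:R).
Proof.
move=> u0 ur b0 vb.
apply: (@le_trans _ _ (\sum_y `|u y| * l1norm (fun x => v (x - y) - v x))).
  rewrite /l1norm; under [leRHS]eq_bigr do rewrite mulr_sumr.
  rewrite exchange_big; apply: ler_sum => x _ /=.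
  have -> : convol u v x = \sum_y u y * (v (x - y) - v x).
    rewrite [RHS](eq_bigr (fun y => u y * v (x - y) - u y * v x)).
      by rewrite sumrB -mulr_suml u0 mul0r subr0.
    by move=> y _; rewrite mulrBr.
  apply: le_trans (ler_norm_sum _ _ _) _; apply: ler_sum => y _.
  by rewrite normrM.
rewrite mulr_suml; apply: ler_sum => y _.
have [->|uy] := eqVneq (u y) 0; first by rewrite normr0 !mul0r.
rewrite ler_wpM2l //; apply: le_trans (vb y) _.
by rewrite ler_wpM2l // ler_nat ur.
Qed.

Lemma l1norm_translate_le (w : G -> R) (r : nat) (L : R) (y : G) :
    0 <= L -> (forall x, w x != 0 -> (n x <= r)%N) ->
    (forall x z, `|w x - w z| <= L * (n (x - z))%:R) ->
  l1norm (fun x => w (x - y) - w x) <= 2 * (vol r)%:R * L * (n y)%:R.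
Proof.
move=> L0 wr wL.
apply: (@le_trans _ _ (\sum_x ((n (x - y)%R <= r)%:R + (n x <= r)%:R) * (L * (n y)%:R))).
  apply: ler_sum => x _.
  have Ln : 0 <= L * (n y)%:R by rewrite mulr_ge0.
  have [h|h] := boolP ((n (x - y)%R <= r) || (n x <= r))%N; last first.
    move: h; rewrite negb_or => /andP[h1 h2].
    have -> : w (x - y) = 0 by apply/eqP; apply: contraNT h1; exact: wr.
    have -> : w x = 0 by apply/eqP; apply: contraNT h2; exact: wr.
    by rewrite subrr normr0 mulr_ge0 // addr_ge0.
  apply: le_trans (wL _ _) _.
  rewrite [(x - y - x)]addrAC subrr add0r nN ler_peMl //.
  by move: h => /orP[] ->; rewrite ?lerDl ?lerDr.
rewrite -mulr_suml big_split /= mulrA -!natr_sum.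
have sb (p : G -> nat) : (\sum_x (p x <= r))%N = #|[set x | (p x <= r)%N]| :> nat.
  by rewrite -sum1dep_card [RHS]big_mkcond; apply: eq_bigr => x _; case: leqP.
rewrite (sb (fun x => n (x - y))) sb card_ball -/(vol r).
by rewrite mulr_natl mulr2n lexx.
Qed.

(** Normalised tents serve as averaging kernels: their translates differ little
    in l^1 as a consequence of the triangle inequality alone, which a ball's
    indicator function would not give. *)
Section Tent.
Variable r : nat.
Hypothesis r_gt0 : (0 < r)%N.

Let hat x : nat := (r.+1 - n x)%N.
Let mass : nat := (\sum_(x : G) hat x)%N.

Definition tent x : R := (hat x)%:R / mass%:R.

(** Half of the ball's radius, and hence by doubling a fixed part of its volume,
    lies where the tent has at least half its height. *)
Let mass_ge : (r * vol r <= 2 * D * mass)%N.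
Proof.
have h1 : (vol r <= D * vol r./2)%N.
  by apply: leq_trans (doubling _); apply: vol_mono; lia.
have h2 : (vol r./2 * (r.+1 - r./2) <= mass)%N.
  rewrite /mass (bigID (fun x => n x <= r./2)%N) /=.
  apply: leq_trans (leq_addr _ _).
  rewrite /vol -sum1dep_card big_distrl /=; apply: leq_sum => x hx.
  by rewrite mul1n /hat; lia.
have h3 : (r <= 2 * (r.+1 - r./2))%N by lia.
apply: (@leq_trans (2 * (r.+1 - r./2) * (D * vol r./2))); first exact: leq_mul.
by rewrite mulnACA leq_mul // mulnC.
Qed.

Let mass_gt0 : (0 < mass)%N.
Proof.
have : (0 < r * vol r)%N by rewrite muln_gt0 r_gt0 vol_gt0.
case: (posnP mass) mass_ge => // ->.
by rewrite muln0 leqn0 => /eqP ->.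
Qed.

Lemma tent_ge0 x : 0 <= tent x. Proof. by rewrite divr_ge0. Qed.

Lemma tent_sum : \sum_x tent x = 1.
Proof. by rewrite -mulr_suml -natr_sum divff // pnatr_eq0 -lt0n. Qed.

Lemma tent_supp x : tent x != 0 -> (n x <= r)%N.
Proof.
apply: contraNT; rewrite -ltnNge => h.
have /eqP hz : (r.+1 - n x == 0)%N by rewrite subn_eq0.
by rewrite /tent /hat hz mul0r.
Qed.

Lemma tent_le x : tent x <= 4 * D%:R / (vol r)%:R.
Proof.
rewrite ler_pdivrMr ?ltr0n // mulrAC ler_pdivlMr ?ltr0n ?vol_gt0 // -!natrM ler_nat.
apply: (@leq_trans (2 * (r * vol r))).
  by rewrite mulnA leq_mul2r /hat; apply/orP; right; lia.
by have := mass_ge; lia.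
Qed.

Lemma tent_translate y :
  l1norm (fun x => tent (x - y) - tent x) <= 4 * D%:R / r%:R * (n y)%:R.
Proof.
have m0 : 0 < mass%:R :> R by rewrite ltr0n.
apply: le_trans (@l1norm_translate_le _ r mass%:R^-1 _ _ tent_supp _) _.
- by rewrite invr_ge0.
- move=> x z; rewrite -mulrBl normrM [`|_^-1|]ger0_norm ?invr_ge0 // mulrC.
  rewrite ler_wpM2l ?invr_ge0 // /hat.
  have h1 : (n x <= n (x - z)%R + n z)%N by have := nD (x - z) z; rewrite subrK.
  have h2 : (n z <= n (x - z)%R + n x)%N.
    by rewrite n_distC; have := nD (z - x) x; rewrite subrK.
  rewrite ler_norml; apply/andP; split.
    by rewrite lerBrDl lerBlDr -natrD ler_nat; lia.
  by rewrite lerBlDr -natrD ler_nat; lia.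
rewrite ler_wpM2r // ler_pdivrMr // mulrAC ler_pdivlMr ?ltr0n // -!natrM ler_nat.
by have := mass_ge; lia.
Qed.

End Tent.

End Doubling.

(** * The discrete weak type inequality *)
Section DiscreteCZ.
Variables (R : archiRealFieldType) (G : finZmodType) (n : G -> nat).
Hypothesis n0 : n 0 = 0%N.
Hypothesis nN : forall x, n (- x) = n x.
Hypothesis nD : forall x y, (n (x + y)%R <= n x + n y)%N.
Variable D : nat.
Hypothesis doubling : forall r, (vol n (r.*2.+1) <= D * vol n r)%N.
(** k l is the layer of a singular kernel at scale 4^l: odd, supported in a ball
    of radius comparable with 4^l, with the size and smoothness of a
    Calderon-Zygmund kernel there. *)
Variables (k : nat -> G -> R) (A : R).
Hypothesis A_ge0 : 0 <= A.
Hypothesis k_odd : forall l x, k l (- x) = - k l x.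
Hypothesis k_supp : forall l x, k l x != 0 -> (n x <= 4 ^ l.+1)%N.
Hypothesis k_lip : forall l x y,
  `|k l x - k l y| <= A * (n (x - y))%:R / ((4 ^ l)%:R * (vol n (4 ^ l))%:R).

Let V := vol n.
Let V_gt0 r : 0 < (V r)%:R :> R. Proof. by rewrite ltr0n vol_gt0. Qed.
Let p4_gt0 l : 0 < (4 ^ l)%:R :> R. Proof. by rewrite ltr0n expn_gt0. Qed.
Let D_gt0' : 0 < D%:R :> R. Proof. by rewrite ltr0n (D_gt0 n0 doubling). Qed.

Let A1 : R := 4 * A * (D ^ 2)%:R.
Let A2 : R := 2 * A * (D ^ 2)%:R.
Let A1_ge0 : 0 <= A1. Proof. by rewrite !mulr_ge0. Qed.
Let A2_ge0 : 0 <= A2. Proof. by rewrite !mulr_ge0. Qed.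

Let V4 l : (V (4 ^ l.+1))%:R <= (D ^ 2)%:R * (V (4 ^ l))%:R :> R.
Proof. by rewrite -natrM ler_nat [(4 ^ _)%N]expnS; exact: vol_quad. Qed.

Let k_parity l : parity (-1) (k l). Proof. by move=> x; rewrite k_odd mulN1r. Qed.

Let k_zerosum l : \sum_x k l x = 0.
Proof.
have : \sum_x k l x = - \sum_x k l x.
  by rewrite -{1}(sum_reflect _ 0) -sumrN; apply: eq_bigr => x _; rewrite sub0r k_odd.
by lra.
Qed.

Let k_l1norm l : l1norm (k l) <= A1.
Proof.
have k0 : k l 0 = 0 by have := k_odd l 0; rewrite oppr0; lra.
apply: (@le_trans _ _ (\sum_(x | (n x <= 4 ^ l.+1)%N) (4 * A / (V (4 ^ l))%:R))).
  rewrite [leRHS]big_mkcond; apply: ler_sum => x _.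
  case: ifPn => [h|h]; last first.
    have -> : k l x = 0 by apply/eqP; apply: contraNT h; exact: k_supp.
    by rewrite normr0.
  have := k_lip l x 0; rewrite k0 !subr0 => /le_trans; apply.
  rewrite ler_pdivrMr ?mulr_gt0 //.
  have -> : 4 * A / (V (4 ^ l))%:R * ((4 ^ l)%:R * (V (4 ^ l))%:R) =
      A * (4 * (4 ^ l)%:R) by field; rewrite gt_eqF.
  by rewrite ler_wpM2l // -natrM -expnS ler_nat.
rewrite big_const -/(V _) iter_addr addr0 -[_ *+ _]mulr_natr.
rewrite mulrAC ler_pdivrMr // /A1 -!mulrA !ler_wpM2l //.
apply: le_trans (V4 l); rewrite ler_nat eq_leq //.
by apply: eq_card => x; rewrite !inE.
Qed.

Let k_translate l y :
  l1norm (fun x => k l (x - y) - k l x) <= A2 / (4 ^ l)%:R * (n y)%:R.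
Proof.
apply: le_trans (l1norm_translate_le nN (r := (4 ^ l.+1)%N)
    (L := A / ((4 ^ l)%:R * (V (4 ^ l))%:R)) y _ _ _) _.
- by rewrite divr_ge0 // mulr_ge0.
- exact: k_supp.
- by move=> x z; rewrite mulrAC; exact: k_lip.
rewrite ler_wpM2r //.
have p0 := p4_gt0 l; have v0 := V_gt0 (4 ^ l).
have -> : 2 * (V (4 ^ l.+1))%:R * (A / ((4 ^ l)%:R * (V (4 ^ l))%:R)) =
    (2 * A / ((4 ^ l)%:R * (V (4 ^ l))%:R)) * (V (4 ^ l.+1))%:R by ring.
apply: le_trans (ler_wpM2l _ (V4 l)) _; first by rewrite !mulr_ge0 // invr_ge0 mulr_ge0 // ltW.
rewrite [leLHS](_ : _ = (2 * A * (D ^ 2)%:R) / (4 ^ l)%:R); last by field; rewrite !gt_eqF.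
by [].
Qed.

(** k i has mean zero and k l is Lipschitz at the larger scale 4^l. *)
Let k_almost_orth i l : (i <= l)%N ->
  l1norm (convol (k i) (k l)) <= 4 * A1 * A2 * (4 ^ i)%:R / (4 ^ l)%:R.
Proof.
move=> il; apply: le_trans (l1norm_convol_zerosum (k_zerosum i)
  (@k_supp i) _ (k_translate l)) _; first by rewrite divr_ge0 // ltW.
have -> : 4 * A1 * A2 * (4 ^ i)%:R / (4 ^ l)%:R =
    A1 * (A2 / (4 ^ l)%:R * (4 ^ i.+1)%:R) by rewrite expnS natrM; ring.
by rewrite ler_wpM2r // mulr_ge0 // divr_ge0.
Qed.

Let K : R := 1 + 4 * A1 * A2.
Let K_gt0 : 0 < K. Proof. by rewrite ltr_wpDr // !mulr_ge0. Qed.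

(** The profile charges a difference m in Z/(J+1) both as m and as J + 1 - m,
    since l - i may wrap around. *)
Let opbound_k J : opbound (fun x => \sum_(0 <= l < J.+1) k l x) (4 * K).
Proof.
have p2 m : 0 < (2 ^ m)%:R^-1 :> R by rewrite invr_gt0 ltr0n expn_gt0.
pose a (m : 'I_J.+1) : R := K * ((2 ^ m)%:R^-1 + (2 ^ (J.+1 - m))%:R^-1).
have a0 m : 0 < a m by rewrite mulr_gt0 // addr_gt0.
have al (m : 'I_J.+1) i l : (i <= l)%N -> (m = l - i :> nat \/ J.+1 - m = l - i)%N ->
    4 * A1 * A2 * (4 ^ i)%:R / (4 ^ l)%:R <= a m ^+ 2.
  move=> il ml.
  have aK : K * (2 ^ (l - i))%:R^-1 <= a m.
    rewrite ler_pM2l //; case: ml => <-; first by rewrite lerDl ltW.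
    by rewrite lerDr ltW.
  apply: (@le_trans _ _ ((K * (2 ^ (l - i))%:R^-1) ^+ 2)); last first.
    by apply: lerXn2r => //; rewrite nnegrE ltW // mulr_gt0.
  rewrite exprMn exprVn -natrX -expnM mulnC expnM -[(2 ^ 2)%N]/4%N.
  have -> : (4 ^ l = 4 ^ (l - i) * 4 ^ i)%N by rewrite -expnD subnK.
  rewrite natrM.
  have := p4_gt0 i; have := p4_gt0 (l - i).
  set x := (4 ^ i)%:R; set y := (4 ^ (l - i))%:R => y0 x0.
  have -> : 4 * A1 * A2 * x / (y * x) = 4 * A1 * A2 / y by field; rewrite !gt_eqF.
  rewrite ler_pM2r ?invr_gt0 // /K.
  have : 0 <= 4 * A1 * A2 by rewrite !mulr_ge0.
  by set z := _ * A2; nra.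
have -> : (fun x => \sum_(0 <= l < J.+1) k l x) = fun x => \sum_(i < J.+1) k i x.
  by apply/funext => x; rewrite big_mkord.
apply: opbound_le (cotlar_stein a0 (s := -1) _ _ _); first last.
- move=> i l; have [il|li] := leqP i l.
    apply: le_trans (k_almost_orth il) _; apply: al => //; left.
    rewrite /= modnDmr addnBA 1?ltnW // addnC -addnBA // addnC modnDr modn_small //.
    exact: leq_ltn_trans (leq_subr _ _) (ltn_ord l).
  rewrite convolC; apply: le_trans (k_almost_orth (ltnW li)) _.
  apply: al => //; first exact: ltnW.
  right; rewrite /= modnDmr modn_small; first by have := ltn_ord i; lia.
  by have := ltn_ord i; lia.
- by move=> i; exact: k_parity.
- by rewrite sqrrN expr1n.
- rewrite -mulr_sumr mulrC ler_pM2r // big_split /=.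
  have h1 : \sum_(m < J.+1) ((2 ^ m)%:R^-1 : R) <= 2.
    by rewrite -(big_mkord xpredT (fun m => ((2 ^ m)%:R^-1 : R))); apply: le_trans (sum_exprV_le _ _ _ _) _; rewrite ?divr1.
  have h2 : \sum_(m < J.+1) ((2 ^ (J.+1 - m))%:R^-1 : R) <= 2.
    rewrite (reindex_inj rev_ord_inj) /=; apply: le_trans h1.
    apply: ler_sum => m _; rewrite lef_pV2 ?posrE ?ltr0n ?expn_gt0 // ler_nat leq_pexp2l //.
    by rewrite subKn //; lia.
  by move: h1 h2; lra.
- by apply: sumr_ge0 => m _; exact: ltW.
Qed.

Let phi i : G -> R := tent n R (4 ^ i)%N.

Let Ce : R := 4 * A2 + 16 * D%:R * A1.

(** Averaging at the small scale 4^i hardly changes the layers at scales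
    4^l >= 4^i: delta_0 - phi i has mean zero. *)
Let k_minus_average i l : (i <= l)%N ->
  l1norm (fun x => k l x - convol (phi i) (k l) x) <=
  2 * (A2 / (4 ^ l)%:R * (4 ^ i)%:R).
Proof.
move=> il.
have r0 : (0 < 4 ^ i)%N by rewrite expn_gt0.
pose dl (x : G) : R := (x == 0)%:R.
have dlE : convol dl (k l) = k l.
  apply/funext => x; rewrite /convol (bigD1 0) //= /dl eqxx mul1r subr0.
  by rewrite big1 ?addr0 // => y /negbTE ->; rewrite mul0r.
have dl1 : \sum_x dl x = 1.
  by rewrite (bigD1 0) //= big1 ?addr0 /dl ?eqxx // => y /negbTE ->.
have p1 := tent_sum n0 doubling R r0.
rewrite -{1}dlE -convolBl.
apply: le_trans (l1norm_convol_zerosum (r := (4 ^ i)%N) _ _ _ (k_translate l)) _.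
- by rewrite sumrB dl1 p1 subrr.
- move=> x; have [->|x0] := eqVneq x 0; first by rewrite n0.
  by rewrite /dl (negbTE x0) sub0r oppr_eq0; exact: tent_supp.
- by rewrite divr_ge0 // ltW.
- rewrite ler_wpM2r ?mulr_ge0 ?invr_ge0 //.
  apply: le_trans (l1normB _ _) _.
  rewrite {1}/l1norm (eq_bigr dl) => [|x _]; last by rewrite ger0_norm.
  rewrite dl1 /l1norm (eq_bigr (phi i)) => [|x _]; last by rewrite ger0_norm ?tent_ge0.
  by rewrite p1; lra.
Qed.

(** Averaging at scale 4^i nearly annihilates the layers at smaller scales,
    which have mean zero. *)
Let average_k i l :
  l1norm (convol (phi i) (k l)) <=
  A1 * (4 * D%:R / (4 ^ i)%:R * (4 ^ l.+1)%:R).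
Proof.
have r0 : (0 < 4 ^ i)%N by rewrite expn_gt0.
rewrite convolC; apply: le_trans (l1norm_convol_zerosum (k_zerosum l)
  (@k_supp l) _ (tent_translate n0 nN nD doubling R r0)) _.
  by rewrite divr_ge0 // mulr_ge0.
by rewrite ler_wpM2r // !mulr_ge0 // invr_ge0.
Qed.

(** The truncation at scale 4^i minus the average, at the same scale, of the
    whole kernel; its l^1 norm is bounded uniformly in i and J, which is
    Cotlar's inequality in kernel form. *)
Let error_kernel J i x : R := \sum_(i <= l < J) k l x -
  convol (phi i) (fun y => \sum_(0 <= l < J) k l y) x.

Let error_kernel_l1norm J i : (i <= J)%N -> l1norm (error_kernel J i) <= Ce.
Proof.
move=> iJ.
have -> : error_kernel J i = fun x =>
    \sum_(i <= l < J) (k l x - convol (phi i) (k l) x) -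
    \sum_(0 <= l < i) convol (phi i) (k l) x.
  apply/funext => x; rewrite /error_kernel convolC convol_suml.
  rewrite sumrB (big_cat_nat (leq0n i) iJ) //= opprD addrA addrAC.
  by congr (_ - _ - _); apply: eq_bigr => l _; rewrite convolC.
apply: le_trans (l1normB _ _) _.
apply: (@le_trans _ _ (\sum_(i <= l < J) 2 * (A2 / (4 ^ l)%:R * (4 ^ i)%:R) +
   \sum_(0 <= l < i) A1 * (4 * D%:R / (4 ^ i)%:R * (4 ^ l.+1)%:R))).
  apply: lerD; apply: le_trans (l1norm_sum _ _ _) _.
    rewrite big_nat [leRHS]big_nat; apply: ler_sum => l /andP[il _].
    exact: k_minus_average.
  by apply: ler_sum => l _; exact: average_k.
have p0 := p4_gt0 i.
have -> : \sum_(i <= l < J) 2 * (A2 / (4 ^ l)%:R * (4 ^ i)%:R) =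
    2 * A2 * (4 ^ i)%:R * \sum_(i <= l < J) (4 ^ l)%:R^-1.
  by rewrite mulr_sumr; apply: eq_bigr => l _; ring.
have -> : \sum_(0 <= l < i) A1 * (4 * D%:R / (4 ^ i)%:R * (4 ^ l.+1)%:R) =
    16 * A1 * D%:R / (4 ^ i)%:R * (\sum_(0 <= l < i) 4 ^ l)%N%:R.
  rewrite natr_sum mulr_sumr; apply: eq_bigr => l _.
  by rewrite expnS natrM; ring.
apply: lerD.
  apply: le_trans (ler_wpM2l _ (sum_exprV_le R i J (isT : 1 < 4)%N)) _.
    by rewrite !mulr_ge0.
  by rewrite le_eqVlt; apply/orP; left; apply/eqP; field; rewrite gt_eqF.
have hs : (\sum_(0 <= l < i) 4 ^ l)%N%:R <= (4 ^ i)%:R :> R.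
  by rewrite ler_nat; exact: sum_expn_le.
apply: le_trans (ler_wpM2l _ hs) _; first by rewrite !mulr_ge0 // invr_ge0.
by rewrite le_eqVlt; apply/orP; left; apply/eqP; field; rewrite gt_eqF.
Qed.

(** Spreading the masses of f.  In this part O plays the role of the set where
    averages of |f| are large, and tau b is an eighth of the distance of b to
    its complement.  Because that distance is Lipschitz, masses spread over a
    common point y have comparable radii and sit in a ball around y that is
    only a bounded factor smaller than a ball centred outside O. *)
Section Smear.
Variables (f : G -> R) (O : {set G}) (z0 : G).
Hypothesis z0O : z0 \notin O.

Let ex_dist b : exists m, [exists z, (z \notin O) && (n (b - z)%R == m)].
Proof. by exists (n (b - z0)); apply/existsP; exists z0; rewrite z0O eqxx. Qed.

Let dist b := ex_minn (ex_dist b).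

Let dist_le b z : z \notin O -> (dist b <= n (b - z)%R)%N.
Proof.
move=> zO; rewrite /dist; case: ex_minnP => m _; apply.
by apply/existsP; exists z; rewrite zO eqxx.
Qed.

Let dist_attained b : exists2 z, z \notin O & n (b - z) = dist b.
Proof.
rewrite /dist; case: ex_minnP => m /existsP[z /andP[zO /eqP zm]] _.
by exists z.
Qed.

Let tau b := (dist b %/ 8)%N.

Let bump r x : R := (n x <= r)%N%:R / (V r)%:R.

Let bump_ge0 r x : 0 <= bump r x. Proof. by rewrite divr_ge0. Qed.

Let bump_sum r : \sum_x bump r x = 1.
Proof.
rewrite /bump -mulr_suml -natr_sum (_ : (\sum_x (n x <= r))%N = V r).
  by rewrite divff // gt_eqF.
by rewrite /V /vol -sum1dep_card [RHS]big_mkcond; apply: eq_bigr => x _; case: leqP.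
Qed.

Definition smear y : R := \sum_b f b * bump (tau b) (y - b).

Lemma smear_l1norm : l1norm smear <= l1norm f.
Proof.
apply: (@le_trans _ _ (\sum_y \sum_b `|f b| * bump (tau b) (y - b))).
  apply: ler_sum => y _; apply: le_trans (ler_norm_sum _ _ _) _.
  by apply: ler_sum => b _; rewrite normrM [`|bump _ _|]ger0_norm.
rewrite exchange_big; apply: ler_sum => b _ /=.
by rewrite -mulr_sumr (sum_translate (bump (tau b))) bump_sum mulr1.
Qed.

(** All masses reaching y lie in a ball of radius 2 dist y + 1 about a point z
    outside O, where growth is controlled.  From dist b <= 8 tau b + 7 one gets
    2 dist y + 1 <= 32 tau b + 31, that is, five doublings of tau b. *)
Lemma smear_bounded c y : 0 < c ->
    (forall z r, z \notin O ->
       \sum_(b | (n (b - z)%R <= r)%N) `|f b| <= c * (V r)%:R) ->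
  `|smear y| <= c * (D ^ 5)%:R.
Proof.
move=> c_gt0 O_growth.
have [z zO yz] := dist_attained y.
pose r := (dist y).*2.+1.
apply: le_trans (ler_norm_sum _ _ _) _.
apply: (@le_trans _ _ (\sum_(b | (n (b - z)%R <= r)%N)
    `|f b| * ((D ^ 5)%:R / (V r)%:R))); last first.
  rewrite -mulr_suml mulrCA [leRHS]mulrC ler_wpM2l //.
  by rewrite ler_pdivrMr // O_growth.
rewrite [leRHS]big_mkcond; apply: ler_sum => b _.
rewrite normrM [`|bump _ _|]ger0_norm // /bump.
have [h|h] := leqP (n (y - b)) (tau b); last first.
  by rewrite mul0r mulr0; case: ifP => // _; rewrite mulr_ge0 // divr_ge0.
have d1 : (dist b <= dist y + tau b)%N.
  apply: leq_trans (dist_le b zO) _; apply: leq_trans (n_tri nD y b z) _.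
  by rewrite (n_distC nN b y) yz addnC leq_add2l.
have d2 : (dist y <= dist b + tau b)%N.
  have [z' zO' bz] := dist_attained b.
  apply: leq_trans (dist_le y zO') _; apply: leq_trans (n_tri nD b y z') _.
  by rewrite bz addnC leq_add2l.
have d3 := leq_trunc_div (dist b) 8; rewrite -/(tau b) in d3.
have d4 := ltn_ceil (dist b) (isT : 0 < 8)%N; rewrite -/(tau b) in d4.
have -> : (n (b - z)%R <= r)%N.
  apply: leq_trans (n_tri nD y b z) _; rewrite (n_distC nN b y) yz.
  by apply: leq_trans (leq_add h (leqnn _)) _; rewrite /r; lia.
rewrite mul1r ler_wpM2l // ler_pdivlMr // mulrC ler_pdivrMr // -natrM ler_nat.
(* r |-> 2r + 1 iterated five times sends tau b to 32 tau b + 31 *)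
have dbl5 t : (V (t.*2.+1.*2.+1.*2.+1.*2.+1.*2.+1) <= D ^ 5 * V t)%N.
  do 5 (apply: leq_trans (doubling _) _; rewrite expnS -mulnA leq_mul2l; apply/orP; right).
  by rewrite expn0 mul1n.
by apply: leq_trans (dbl5 (tau b)); apply: vol_mono; rewrite /r; lia.
Qed.

(** The absolute values are taken layer by layer, so the error dominates that of
    all truncations simultaneously. *)
Definition smear_error J q : R := \sum_b `|f b| *
  \sum_u bump (tau b) u * \sum_(0 <= l < J) `|k l (q - b - u) - k l (q - b)|.

(** A layer k l sees the displacement u of the mass at b, from a point q outside
    O and hence at distance at least 8 tau b, only if 4^(l+1) >= tau b; it then
    contributes at most A2 tau b / 4^l. *)
Lemma smear_error_sum J : \sum_(q | q \notin O) smear_error J q <= 6 * A2 * l1norm f.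
Proof.
rewrite /smear_error exchange_big mulr_sumr; apply: ler_sum => b _ /=.
rewrite -mulr_sumr [leRHS]mulrC ler_wpM2l // exchange_big /=.
apply: (@le_trans _ _ (\sum_u bump (tau b) u * (6 * A2))); last first.
  by rewrite -mulr_suml bump_sum mul1r.
apply: ler_sum => u _; rewrite -mulr_sumr.
have [h|h] := leqP (n u) (tau b); last first.
  by rewrite /bump leqNgt h !mul0r.
rewrite ler_wpM2l // exchange_big /=.
apply: (@le_trans _ _ (\sum_(0 <= l < J | (tau b <= 4 ^ l.+1)%N)
    A2 * ((tau b)%:R / (4 ^ l)%:R))); last first.
  by rewrite -mulr_sumr mulrC ler_wpM2r // sum_scaled_tail.
rewrite [leRHS]big_mkcond; apply: ler_sum => l _.
have d3 := leq_trunc_div (dist b) 8; rewrite -/(tau b) in d3.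
case: leqP => tl; last first.
  rewrite big1 // => q qO.
  have dq : (dist b <= n (q - b)%R)%N by rewrite (n_distC nN) dist_le.
  have -> : k l (q - b) = 0.
    by apply/eqP/negP => /negP/k_supp; lia.
  have -> : k l (q - b - u) = 0; last by rewrite subrr normr0.
  apply/eqP/negP => /negP/k_supp.
  by have := nD (q - b - u) u; rewrite subrK; lia.
apply: le_trans (_ : l1norm (fun x => k l (x - u) - k l x) <= _).
  rewrite /l1norm -(sum_translate (fun x => `|k l (x - u) - k l x|) b).
  by rewrite [leRHS](bigID (fun q => q \notin O)) /= lerDl sumr_ge0.
apply: le_trans (k_translate _ _) _.
by rewrite mulrAC mulrA ler_pM2r ?invr_gt0 // ler_wpM2l // ler_nat.
Qed.

Lemma smear_approx J i q :
  `|\sum_b f b * \sum_(i <= l < J) k l (q - b) -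
    convol (fun x => \sum_(i <= l < J) k l x) smear q| <= smear_error J q.
Proof.
have -> : convol (fun x => \sum_(i <= l < J) k l x) smear q =
    \sum_b f b * \sum_u bump (tau b) u * \sum_(i <= l < J) k l (q - b - u).
  rewrite convolC /convol /smear.
  under eq_bigr do rewrite mulr_suml.
  rewrite exchange_big; apply: eq_bigr => b _ /=.
  rewrite mulr_sumr -(sum_translate _ (- b)); apply: eq_bigr => u _.
  by rewrite opprK addrK opprD addrA addrAC mulrA.
rewrite -sumrB; apply: le_trans (ler_norm_sum _ _ _) _.
apply: ler_sum => b _; rewrite -mulrBr normrM ler_wpM2l //.
have {1}-> : \sum_(i <= l < J) k l (q - b) =
    \sum_u bump (tau b) u * \sum_(i <= l < J) k l (q - b).
  by rewrite -mulr_suml bump_sum mul1r.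
rewrite -sumrB; apply: le_trans (ler_norm_sum _ _ _) _.
apply: ler_sum => u _; rewrite -mulrBr normrM ger0_norm // ler_wpM2l //.
rewrite -sumrB; apply: le_trans (ler_norm_sum _ _ _) _.
have [iJ|Ji] := leqP i J; last by rewrite big_geq ?sumr_ge0 // ltnW.
rewrite [leRHS](big_cat_nat (leq0n i) iJ) //= ler_wpDl ?sumr_ge0 //.
by apply: ler_sum => l _; rewrite distrC.
Qed.

End Smear.

(** The height c is chosen so that the error kernel, applied to a function
    bounded by c D^5, gives at most 1/4. *)
Let c : R := (4 * (Ce + 1) * (D ^ 5)%:R)^-1.

Let Ce_ge0 : 0 <= Ce. Proof. by rewrite addr_ge0 // !mulr_ge0. Qed.

Let D5_gt0 : 0 < (D ^ 5)%:R :> R.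
Proof. by rewrite ltr0n expn_gt0 (D_gt0 n0 doubling). Qed.

Let c_gt0 : 0 < c.
Proof. by rewrite invr_gt0 mulr_gt0 // mulr_gt0 // ltr_wpDl. Qed.

(** Jensen's inequality for the probability weights phi i. *)
Let average_sqr_le i (h : G -> R) q :
  convol (phi i) h q ^+ 2 <= 4 * D%:R / (V (4 ^ i))%:R *
    \sum_(b | (n (b - q)%R <= 4 ^ i)%N) h b ^+ 2.
Proof.
have r0 : (0 < 4 ^ i)%N by rewrite expn_gt0.
apply: (@le_trans _ _ ((\sum_y phi i y) * \sum_y phi i y * h (q - y) ^+ 2)).
  apply: sqr_sum_le => y; [exact: tent_ge0|by rewrite mulr_ge0 ?tent_ge0 ?sqr_ge0|].
  by rewrite exprMn [X in X * _]expr2 [leRHS]mulrA.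
rewrite (tent_sum n0 doubling R r0) mul1r mulr_sumr [leRHS]big_mkcond.
rewrite -[leRHS](sum_reflect _ q); apply: ler_sum => y _.
rewrite addrAC subrr add0r nN; case: ifPn => [h1|h1].
  by rewrite ler_wpM2r ?sqr_ge0 //; exact: (tent_le n0 doubling R r0 y).
suff -> : phi i y = 0 by rewrite mul0r.
by apply/eqP; apply: contraNT h1; exact: tent_supp.
Qed.

Definition weak_type_const : R :=
  D%:R / c + 24 * A2 + 256 * K ^+ 2 * c * (D ^ 7)%:R.

(** Outside O a bad point has either a smearing error above 1/4 or, the error
    kernel contributing at most 1/4, an average of h = k * g above 1/2; then the
    average of h^2 is above 1/4. *)
Theorem discrete_maximal_weak_type (J : nat) (f : G -> R) (S : {set G}) :
    (forall q, q \in S -> exists2 i, (i <= J)%N &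
       1 < `|\sum_b f b * \sum_(i <= l < J) k l (q - b)|) ->
  #|S|%:R <= weak_type_const * l1norm f.
Proof.
rewrite /weak_type_const => hS.
pose O := [set q | `[< exists r, c * (V r)%:R <=
   \sum_(b | (n (b - q)%R <= r)%N) `|f b| >]].
have cO : #|O|%:R <= D%:R / c * l1norm f.
  have /choice[rho hrho] : forall q, exists r, q \in O -> c * (V r)%:R <=
      \sum_(b | (n (b - q)%R <= r)%N) `|f b|.
    move=> q; have [|_] := boolP (q \in O); last by exists 0%N.
    by rewrite inE => /asboolP[r hr]; exists r.
  have := maximal_weak_type n0 nN nD doubling (fun x => normr_ge0 (f x)) (ltW c_gt0) hrho.
  by rewrite -mulrAC ler_pdivlMr // [X in X <= _]mulrC.
have f0 := l1norm_ge0 f.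
have rest0 : 0 <= 24 * A2 by rewrite mulr_ge0.
have rest1 : 0 <= 256 * K ^+ 2 * c * (D ^ 7)%:R.
  by rewrite mulr_ge0 // mulr_ge0 ?(ltW c_gt0) // mulr_ge0 ?sqr_ge0.
have [SO|] := boolP (S \subset O).
  apply: (@le_trans _ _ #|O|%:R); first by rewrite ler_nat subset_leq_card.
  by apply: le_trans cO _; rewrite ler_wpM2r // -addrA lerDl addr_ge0.
case/fintype.subsetPn => z0 z0S z0O.
have growth z r : z \notin O ->
    \sum_(b | (n (b - z)%R <= r)%N) `|f b| <= c * (V r)%:R.
  rewrite inE => /asboolPn hz; apply/ltW; rewrite ltNge; apply/negP => h.
  by apply: hz; exists r.
pose g := smear f z0O.
pose err J q := smear_error f z0O J q.
have gsup y : `|g y| <= c * (D ^ 5)%:R by exact: smear_bounded.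
have gl1 : l1norm g <= l1norm f by exact: smear_l1norm.
have err0 q : 0 <= err J q.
  apply: sumr_ge0 => b _; rewrite mulr_ge0 //; apply: sumr_ge0 => u _.
  by rewrite mulr_ge0 ?divr_ge0 ?sumr_ge0.
pose S2 := [set q | (q \notin O) && (4^-1 < err J q)].
pose S3 := S :\: (O :|: S2).
have cS2 : #|S2|%:R <= 24 * A2 * l1norm f.
  have : 4^-1 * #|S2|%:R <= 6 * A2 * l1norm f.
    apply: le_trans _ (smear_error_sum f z0O J).
    rewrite mulr_natr -sumr_const.
    rewrite big_mkcond [leRHS]big_mkcond; apply: ler_sum => q _.
    rewrite inE; case: ifP => [/andP[-> h]|]; first exact: ltW.
    by move=> _; case: ifP => // _; exact: err0.
  by lra.
have gl2 : sqnorm g <= c * (D ^ 5)%:R * l1norm f.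
  apply: (@le_trans _ _ (c * (D ^ 5)%:R * l1norm g)).
    rewrite mulr_sumr; apply: ler_sum => y _.
    rewrite -real_normK ?num_real // expr2 ler_wpM2r //; exact: gsup.
  by rewrite ler_wpM2l // mulr_ge0 // ltW.
have cS3 : #|S3|%:R <= 256 * K ^+ 2 * c * (D ^ 7)%:R * l1norm f.
  case: J @err err0 @S2 cS2 @S3 hS => [|J] err err0 S2 cS2 S3 hS.
    suff -> : S3 = finset.set0 by rewrite cards0 mulr_ge0.
    apply/finset.setP => q; rewrite !inE; apply/negP => /andP[_ /hS[i _]].
    rewrite big1 ?normr0 ?ltr10 // => b _.
    by rewrite big_geq ?mulr0.
  pose kk := fun x => \sum_(0 <= l < J.+1) k l x.
  pose h := convol kk g.
  have hl2 : sqnorm h <= (4 * K) ^+ 2 * (c * (D ^ 5)%:R * l1norm f).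
    apply: le_trans (opbound_k J g) _.
    by rewrite ler_wpM2l ?sqr_ge0.
  have key q : q \in S3 -> exists i,
      (16 * D%:R)^-1 * (V (4 ^ i))%:R <= \sum_(b | (n (b - q)%R <= 4 ^ i)%N) h b ^+ 2.
    case/setDP => qS; rewrite finset.in_setU negb_or => /andP[qO qS2].
    have [i iJ hi] := hS _ qS; exists i.
    have qerr : err J.+1 q <= 4^-1.
      by rewrite leNgt; apply: contraNN qS2 => hq; rewrite inE; apply/andP; split.
    have := smear_approx f z0O J.+1 i q; rewrite -/g -/(err _ _) => happ.
    have herr : `|convol (error_kernel J.+1 i) g q| <= 4^-1.
      apply: le_trans (convol_le_sup _ _ gsup) _.
      apply: (@le_trans _ _ ((Ce + 1) * (c * (D ^ 5)%:R))).
        rewrite ler_wpM2r ?mulr_ge0 ?(ltW c_gt0) //.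
        by apply: le_trans (error_kernel_l1norm iJ) _; rewrite lerDl.
      rewrite le_eqVlt; apply/orP; left; apply/eqP; rewrite /c.
      by field; rewrite !gt_eqF // ltr_wpDl.
    have split_conv : convol (fun x => \sum_(i <= l < J.+1) k l x) g q =
        convol (error_kernel J.+1 i) g q + convol (phi i) h q.
      rewrite /h convolA -[RHS]/((fun x => _ + _) q) -convolDl.
      by congr (convol _ g q); apply/funext => x; rewrite /error_kernel subrK.
    have big : 2^-1 < `|convol (phi i) h q|.
      move: happ hi herr qerr; rewrite split_conv.
      set X := \sum_b _; set Y := convol _ g q; set Z := convol _ h q.
      have := ler_normB X (X - (Y + Z)); rewrite opprB addrC subrK.
      have := ler_normD Y Z.
      have := ler_normD (X - (Y + Z)) (Y + Z); rewrite subrK.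
      by lra.
    have : 4^-1 <= convol (phi i) h q ^+ 2.
      rewrite -real_normK ?num_real //.
      have -> : (4^-1 : R) = 2^-1 ^+ 2 by rewrite expr2; field.
      by apply: lerXn2r; rewrite ?nnegrE ?invr_ge0 // ltW.
    move=> /le_trans/(_ (average_sqr_le i h q)).
    set T := \sum_(b | _) _ => hT.
    have v0 := V_gt0 (4 ^ i).
    rewrite ler_pdivrMl ?mulr_gt0 //.
    have : 4^-1 * (V (4 ^ i))%:R <= 4 * D%:R * T.
      by rewrite -ler_pdivlMr // mulrAC.
    by lra.
  have /choice[rho hrho] : forall q, exists r, q \in S3 ->
      (16 * D%:R)^-1 * (V r)%:R <= \sum_(b | (n (b - q)%R <= r)%N) h b ^+ 2.
    move=> q; have [/key[i hi]|_] := boolP (q \in S3); last by exists 0%N.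
    by exists (4 ^ i)%N.
  have lam0 : 0 <= (16 * D%:R)^-1 :> R by rewrite invr_ge0 mulr_ge0.
  have := maximal_weak_type n0 nN nD doubling (fun x => sqr_ge0 (h x)) lam0 hrho.
  rewrite ler_pdivrMl ?mulr_gt0 // => /le_trans; apply.
  apply: (@le_trans _ _ (16 * D%:R * (D%:R * ((4 * K) ^+ 2 * (c * (D ^ 5)%:R * l1norm f))))).
    by rewrite ler_wpM2l ?mulr_ge0 // ler_wpM2l.
  by rewrite !natrX le_eqVlt; apply/orP; left; apply/eqP; ring.
have : (#|S| <= #|O| + #|S2| + #|S3|)%N.
  apply: leq_trans (subset_leq_card (_ : S \subset O :|: S2 :|: S3)) _.
    by apply/fintype.subsetP => q qS; rewrite !inE qS andbT orbN.
  apply: leq_trans (leq_card_setU _ _) _; rewrite leq_add2r.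
  exact: leq_card_setU.
rewrite -(ler_nat R) !natrD => /le_trans; apply.
rewrite [leRHS]mulrDl [X in _ <= X + _]mulrDl.
exact: (lerD (lerD cO cS2) cS3).
Qed.

End DiscreteCZ.

(** * The Euclidean norm and smooth truncations of the Riesz kernel *)
Section EuclideanNorm.
Variables (R : realType) (d : nat).
Implicit Types x y z : 'rV[R]_d.

Lemma enorm_ge0 x : 0 <= enorm x. Proof. exact: sqrtr_ge0. Qed.

Lemma enorm_sqr x : enorm x ^+ 2 = \sum_i x 0 i ^+ 2.
Proof. by rewrite sqr_sqrtr // sumr_ge0 // => i _; exact: sqr_ge0. Qed.

Lemma enormN x : enorm (- x) = enorm x.
Proof. by congr Num.sqrt; apply: eq_bigr => i _; rewrite mxE sqrrN. Qed.

Lemma enormC x y : enorm (x - y) = enorm (y - x).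
Proof. by rewrite -enormN opprB. Qed.

Lemma coord_le_enorm x i : `|x 0 i| <= enorm x.
Proof.
rewrite -ler_sqr ?nnegrE ?enorm_ge0 // real_normK ?num_real // enorm_sqr.
by rewrite (bigD1 i) //= lerDl sumr_ge0 // => j _; exact: sqr_ge0.
Qed.

Lemma enormD x y : enorm (x + y) <= enorm x + enorm y.
Proof.
rewrite -ler_sqr ?nnegrE ?addr_ge0 ?enorm_ge0 //.
rewrite sqrrD !enorm_sqr.
have -> : \sum_i (x + y) 0 i ^+ 2 =
    \sum_i x 0 i ^+ 2 + (\sum_i x 0 i * y 0 i) *+ 2 + \sum_i y 0 i ^+ 2.
  rewrite -sumrMnl -!big_split; apply: eq_bigr => i _ /=.
  by rewrite mxE sqrrD.
rewrite lerD2r lerD2l lerMn2r /= (le_trans (ler_norm _)) //.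
rewrite -ler_sqr ?nnegrE ?mulr_ge0 ?enorm_ge0 // real_normK ?num_real //.
rewrite exprMn !enorm_sqr; apply: sqr_sum_le => i; rewrite ?sqr_ge0 //.
by rewrite exprMn.
Qed.

Lemma enorm_le_sum x : enorm x <= \sum_i `|x 0 i|.
Proof.
have s0 : 0 <= \sum_i `|x 0 i| by rewrite sumr_ge0.
rewrite -ler_sqr ?nnegrE ?enorm_ge0 // enorm_sqr expr2 mulr_sumr.
apply: ler_sum => i _; rewrite -real_normK ?num_real // expr2 ler_wpM2r //.
by rewrite (bigD1 i) //= lerDl sumr_ge0.
Qed.

Lemma enorm_le_const x B : (forall i, `|x 0 i| <= B) -> enorm x <= d%:R * B.
Proof.
move=> xB; apply: le_trans (enorm_le_sum x) _.
apply: (@le_trans _ _ (\sum_(i < d) B)); first exact: ler_sum.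
by rewrite sumr_const card_ord mulr_natl.
Qed.

Lemma enormZ a x : enorm (a *: x) = `|a| * enorm x.
Proof.
rewrite /enorm; under eq_bigr do rewrite mxE exprMn.
by rewrite -mulr_sumr sqrtrM ?sqr_ge0 // sqrtr_sqr.
Qed.

Lemma enorm_dist x y : enorm x - enorm y <= enorm (x - y).
Proof. by rewrite lerBlDr; have := enormD (x - y) y; rewrite subrK. Qed.

End EuclideanNorm.

Section SmoothTruncation.
Variables (R : realType) (d : nat).
Implicit Types z : 'rV[R]_d.

(** The j-th coordinate of the Riesz kernel of order d, truncated at radius rho
    by freezing the denominator.  Unlike the sharp truncation it is Lipschitz. *)
Definition strunc (j : 'I_d) (rho : R) z : R :=
  z 0 j / Num.max (enorm z) rho ^+ d.+1.

Lemma one_sub_expr_le (y : R) n : 0 <= y -> y <= 1 -> 1 - y ^+ n <= n%:R * (1 - y).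
Proof.
move=> y0 y1; elim: n => [|n IH]; first by rewrite expr0 subrr mul0r.
rewrite exprS -natr1 mulrDl mul1r.
have -> : 1 - y * y ^+ n = y * (1 - y ^+ n) + (1 - y) by ring.
rewrite lerD2r; apply: le_trans IH.
by rewrite ler_piMl // subr_ge0 exprn_ile1.
Qed.

(** The lower bound t for both denominators turns one estimate into the two that
    are needed: the global Lipschitz bound (t = rho) and the decay
    |z|^{-d-1} of differences far from the origin. *)
Lemma strunc_lip j rho z z' t : 0 < t ->
    t <= Num.max (enorm z) rho -> t <= Num.max (enorm z') rho ->
  `|strunc j rho z - strunc j rho z'| <=
    d.+2%:R * enorm (z - z') / t ^+ d.+1.
Proof.
move=> t0; wlog le_zz' : z z' / enorm z <= enorm z'.
  move=> H tz tz'; have [h|/ltW h] := leP (enorm z) (enorm z'); first exact: H.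
  by rewrite distrC enormC; exact: H.
rewrite /strunc; set a := Num.max (enorm z) rho; set b := Num.max (enorm z') rho.
move=> ta tb.
have a0 : 0 < a by exact: lt_le_trans ta.
have b0 : 0 < b by exact: lt_le_trans tb.
have ab : a <= b by rewrite /a /b ge_max !le_max le_zz' lexx orbT.
set e := enorm (z - z').
have e0 : 0 <= e by exact: enorm_ge0.
have bae : b - a <= e.
  have h1 : enorm z' - enorm z <= e by rewrite /e enormC enorm_dist.
  rewrite /b; case: (leP (enorm z') rho) => h; last first.
    by apply: le_trans h1; rewrite lerD2l lerN2 /a le_max lexx.
  apply: le_trans e0; rewrite subr_le0 /a le_max lexx orbT //.
have za : `|z 0 j| <= a.
  by apply: le_trans (coord_le_enorm _ _) _; rewrite /a le_max lexx.
have zz : `|z 0 j - z' 0 j| <= e.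
  by have := coord_le_enorm (z - z') j; rewrite !mxE.
have tn : 0 < t ^+ d.+1 by rewrite exprn_gt0.
have an : 0 < a ^+ d.+1 by rewrite exprn_gt0.
have bn : 0 < b ^+ d.+1 by rewrite exprn_gt0.
have ian : (a ^+ d.+1)^-1 <= (t ^+ d.+1)^-1.
  by rewrite lef_pV2 ?posrE //; apply: lerXn2r => //; exact: ltW.
have ibn : (b ^+ d.+1)^-1 <= (t ^+ d.+1)^-1.
  by rewrite lef_pV2 ?posrE //; apply: lerXn2r => //; exact: ltW.
have -> : z 0 j / a ^+ d.+1 - z' 0 j / b ^+ d.+1 =
    (z 0 j - z' 0 j) / b ^+ d.+1 + z 0 j * ((a ^+ d.+1)^-1 - (b ^+ d.+1)^-1).
  by ring.
apply: le_trans (ler_normD _ _) _.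
have -> : d.+2%:R * e / t ^+ d.+1 =
    e / t ^+ d.+1 + d.+1%:R * e / t ^+ d.+1 :> R.
  by rewrite -natr1; ring.
apply: lerD.
  rewrite normrM; apply: ler_pM => //.
  by rewrite ger0_norm // invr_ge0 ltW.
set y := a / b.
have y0 : 0 <= y by rewrite divr_ge0 // ltW.
have y1 : y <= 1 by rewrite ler_pdivrMr // mul1r.
have dE : (a ^+ d.+1)^-1 - (b ^+ d.+1)^-1 = (a ^+ d.+1)^-1 * (1 - y ^+ d.+1).
  by rewrite /y expr_div_n; field; rewrite !gt_eqF.
have h0 : 0 <= 1 - y ^+ d.+1 by rewrite subr_ge0 exprn_ile1.
rewrite normrM dE normrM [`|_^-1|]ger0_norm ?invr_ge0 ?(ltW an) //.
rewrite [`|1 - _|]ger0_norm //.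
apply: (@le_trans _ _ (a * ((t ^+ d.+1)^-1 * (d.+1%:R * (1 - y))))).
  apply: ler_pM => //; first by rewrite mulr_ge0 // invr_ge0 ltW.
  by apply: ler_pM => //; [rewrite invr_ge0 ltW | exact: one_sub_expr_le].
have -> : a * ((t ^+ d.+1)^-1 * (d.+1%:R * (1 - y))) =
    d.+1%:R * (a * (1 - y)) / t ^+ d.+1 by ring.
rewrite ler_pM2r ?invr_gt0 // ler_wpM2l //; apply: le_trans bae.
have -> : a * (1 - y) = y * (b - a) by rewrite /y; field; rewrite gt_eqF.
by rewrite ler_piMl // subr_ge0.
Qed.

Lemma strunc_bound j rho z : 0 < rho -> `|strunc j rho z| <= (rho ^+ d)^-1.
Proof.
move=> r0; rewrite /strunc; set b := Num.max _ _.
have rb : rho <= b by rewrite /b le_max lexx orbT.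
have b0 : 0 < b by exact: lt_le_trans rb.
rewrite normrM [`|_^-1|]ger0_norm ?invr_ge0 ?exprn_ge0 ?(ltW b0) //.
apply: (@le_trans _ _ (b / b ^+ d.+1)).
  rewrite ler_pM2r ?invr_gt0 ?exprn_gt0 //.
  by apply: le_trans (coord_le_enorm _ _) _; rewrite /b le_max lexx.
rewrite exprS invfM mulrA divff ?gt_eqF // mul1r.
by rewrite lef_pV2 ?posrE ?exprn_gt0 //; apply: lerXn2r => //; exact: ltW.
Qed.

Lemma strunc_eq j rho rho' z : rho <= enorm z -> rho' <= enorm z ->
  strunc j rho z = strunc j rho' z.
Proof. by move=> h h'; rewrite /strunc !max_l. Qed.

Lemma struncN j rho z : strunc j rho (- z) = - strunc j rho z.
Proof. by rewrite /strunc enormN mxE mulNr. Qed.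

End SmoothTruncation.

(** * The torus (Z/M)^d *)
Section Torus.
Variables (m : nat).
Notation M := m.*2.+1.

(** M = 2m + 1 is odd, so the representatives [centered] in [-m, m] are
    symmetric and oddness passes to the torus. *)
Definition residue (z : int) : 'I_M := inZp `|(z %% M%:Z)%Z|%N.

Definition centered (a : 'I_M) : int :=
  if (a <= m)%N then a%:Z else a%:Z - M%:Z.

Lemma residueP (z : int) : exists q : int, z = q * M%:Z + (residue z : nat)%:Z.
Proof.
exists (z %/ M%:Z)%Z.
have h0 : (0 <= z %% M%:Z)%Z by rewrite modz_ge0.
have h1 : (z %% M%:Z < M%:Z)%Z by rewrite ltz_pmod.
rewrite /residue /= modn_small; last by lia.
by rewrite gez0_abs // -divz_eq.
Qed.

Lemma residue_eq (z : int) (a : 'I_M) (q : int) :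
  z = q * M%:Z + (a : nat)%:Z -> residue z = a.
Proof.
move=> za; apply: val_inj.
have aM : (a < M)%N by [].
rewrite /residue /= za modzMDl modz_small; last by apply/andP; split; lia.
by rewrite absz_nat modn_small.
Qed.

Lemma residueD y z : residue (y + z) = residue y + residue z.
Proof.
have [p yp] := residueP y; have [q zq] := residueP z.
set a := residue y in yp *; set b := residue z in zq *.
apply: (@residue_eq _ _ (p + q + ((a + b) %/ M)%N%:Z)).
have -> : ((a + b)%R : nat) = ((a + b) %% M)%N by [].
have := divn_eq (a + b) M; move: (_ %/ _)%N (_ %% _)%N => u v uv.
have : (a + b)%N%:Z = u%:Z * M%:Z + v%:Z by rewrite uv PoszD PoszM.
rewrite PoszD yp zq => e; rewrite addrACA -mulrDl e; ring.
Qed.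

Lemma residueN z : residue (- z) = - residue z.
Proof.
apply/eqP; rewrite -addr_eq0 addrC -residueD subrr.
by apply/eqP; apply: (@residue_eq _ _ 0); rewrite mul0r.
Qed.

Lemma residueB y z : residue (y - z) = residue y - residue z.
Proof. by rewrite residueD residueN. Qed.

Lemma centeredK a : residue (centered a) = a.
Proof.
rewrite /centered; case: ifP => _.
  by apply: (@residue_eq _ _ 0); rewrite mul0r add0r.
by apply: (@residue_eq _ _ (-1)); rewrite mulN1r addrC.
Qed.

Lemma centered_le a : (`|centered a| <= m)%N.
Proof. by rewrite /centered; have := ltn_ord a; case: ifP; lia. Qed.

Lemma residueK z : (`|z| <= m)%N -> centered (residue z) = z.
Proof.
move=> zm; have [q zq] := residueP z; have := ltn_ord (residue z).
rewrite /centered; set a := residue z in zq *; move=> aM.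
case: ifP => am.
  have : q = 0 by nia.
  by move=> q0; rewrite zq q0; lia.
have : q = -1 by nia.
by move=> q1; rewrite zq q1; lia.
Qed.

Lemma centered_residue_le z : (`|centered (residue z)| <= `|z|)%N.
Proof.
have [h|h] := leqP `|z| m; first by rewrite residueK.
by apply: leq_trans (centered_le _) _; exact: ltnW.
Qed.

Lemma centeredN a : centered (- a) = - centered a.
Proof. by rewrite -{1}(centeredK a) -residueN residueK // abszN centered_le. Qed.

Lemma centeredD_le a b :
  (`|centered (a + b)%R| <= `|centered a| + `|centered b|)%N.
Proof.
rewrite -{1}(centeredK a) -{1}(centeredK b) -residueD.
by apply: leq_trans (centered_residue_le _) _; lia.
Qed.

Lemma centeredB a b : (`|centered a| + `|centered b| <= m)%N ->
  centered (a - b) = centered a - centered b.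
Proof.
move=> h; rewrite -{1}(centeredK a) -{1}(centeredK b) -residueB residueK //.
by lia.
Qed.

Definition arc (r : nat) := [set a : 'I_M | (`|centered a| <= r)%N].

Lemma card_arc_le r : (#|arc r| <= r.*2.+1)%N.
Proof.
rewrite -[X in (_ <= X)%N]card_ord.
apply: leq_trans (leq_imset_card (fun i : 'I_(r.*2.+1) => residue (i%:Z - r%:Z)) _).
apply/subset_leq_card/fintype.subsetP => a; rewrite inE => ar.
have h : (`|(centered a + r%:Z)%R| < r.*2.+1)%N by lia.
apply/imsetP; exists (Ordinal h) => //=.
by rewrite gez0_abs; [rewrite addrK centeredK | lia].
Qed.

(** An arc of radius 2r + 1 is covered by three translates of an arc of
    radius r. *)
Lemma card_arc_doubling r : (#|arc (r.*2.+1)| <= 3 * #|arc r|)%N.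
Proof.
set t := residue (r.*2.+1)%:Z.
have sub : arc (r.*2.+1) \subset
   arc r :|: ((fun a => a + t) @: arc r :|: (fun a => a - t) @: arc r).
  apply/fintype.subsetP => a; rewrite !inE => ar.
  have [h1|h1] //= := leqP `|centered a| r.
  have [a0|a0] := leP 0 (centered a).
    apply/orP; left; apply/imsetP; exists (a - t); rewrite ?subrK //.
    rewrite inE -{1}(centeredK a) -residueB.
    by apply: leq_trans (centered_residue_le _) _; lia.
  apply/orP; right; apply/imsetP; exists (a + t); rewrite ?addrK //.
  rewrite inE -{1}(centeredK a) -residueD.
  by apply: leq_trans (centered_residue_le _) _; lia.
apply: leq_trans (subset_leq_card sub) _.
apply: leq_trans (leq_card_setU _ _) _.
have h2 := leq_card_setU ((fun a => a + t) @: arc r) ((fun a => a - t) @: arc r).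
have h3 := leq_imset_card (fun a => a + t) (arc r).
have h4 := leq_imset_card (fun a => a - t) (arc r).
by move: h2 h3 h4; rewrite !mulSn mul0n addn0 => h2 h3 h4; rewrite leq_add2l (leq_trans h2) // leq_add.
Qed.

Variable d : nat.
Notation G := 'rV['I_M]_d.

Definition tnorm (x : G) : nat := (\max_(k < d) `|centered (x 0%R k)|)%N.

Lemma tnorm_leP (x : G) r :
  reflect (forall k, (`|centered (x 0%R k)| <= r)%N) (tnorm x <= r)%N.
Proof. by apply: (iffP (@bigmax_leqP _ _ _ _)) => [h k|h k _]; exact: h. Qed.

Lemma coord_le_tnorm (x : G) k : (`|centered (x 0%R k)| <= tnorm x)%N.
Proof. by move: k; apply/tnorm_leP. Qed.

Lemma tnorm0 : tnorm 0 = 0%N.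
Proof.
by apply/eqP; rewrite -leqn0; apply/tnorm_leP => k; rewrite mxE.
Qed.

Lemma tnormN x : tnorm (- x) = tnorm x.
Proof. by apply: eq_bigr => k _; rewrite mxE centeredN abszN. Qed.

Lemma tnormD (x y : G) : (tnorm (x + y)%R <= tnorm x + tnorm y)%N.
Proof.
apply/tnorm_leP => k; rewrite mxE; apply: leq_trans (centeredD_le _ _) _.
by rewrite leq_add // coord_le_tnorm.
Qed.

Lemma vol_tnorm r : vol tnorm r = (#|arc r| ^ d)%N.
Proof.
rewrite /vol -[X in (_ ^ X)%N]card_ord -card_ffun_on.
pose g (f : {ffun 'I_d -> 'I_M}) : G := \row_k f k.
have ginj : injective g.
  by move=> f1 f2 /rowP h; apply/ffunP => k; have := h k; rewrite !mxE.
rewrite -(card_imset _ ginj); apply: eq_card => x; rewrite inE.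
apply/tnorm_leP/imsetP => [h|[f /ffun_onP hf ->] k]; last first.
  by rewrite mxE; have := hf k; rewrite inE.
exists [ffun k => x 0%R k]; last by apply/rowP => k; rewrite mxE ffunE.
by apply/ffun_onP => k; rewrite ffunE inE.
Qed.

Lemma vol_tnorm_doubling r : (vol tnorm (r.*2.+1) <= 3 ^ d * vol tnorm r)%N.
Proof.
rewrite !vol_tnorm -expnMn.
by case: d => // d'; rewrite leq_exp2r // card_arc_doubling.
Qed.

Lemma vol_tnorm_le r : (vol tnorm r <= r.*2.+1 ^ d)%N.
Proof.
rewrite vol_tnorm; case: d => // d'; rewrite leq_exp2r //; exact: card_arc_le.
Qed.

End Torus.

Section TorusKernel.
Variables (R : realType) (d J : nat) (j : 'I_d).
Let m := (2 * 4 ^ J)%N.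
Notation M := m.*2.+1.
Notation G := 'rV['I_M]_d.

Let p4_gt0 l : 0 < (4 ^ l)%:R :> R. Proof. by rewrite ltr0n expn_gt0. Qed.

Definition lift_vec (x : G) : 'rV[R]_d := \row_i (centered (x 0 i))%:~R.

Lemma enorm_lift_le x : enorm (lift_vec x) <= d%:R * (tnorm x)%:R.
Proof.
apply: enorm_le_const => i; rewrite mxE -intr_norm -abszE -pmulrn ler_nat.
exact: coord_le_tnorm.
Qed.

(** The difference of two consecutive truncations vanishes for |z| >= 4^(l+1). *)
Let layer l (z : 'rV[R]_d) : R :=
  strunc j (4 ^ l)%:R z - strunc j (4 ^ l.+1)%:R z.

Let layer_eq0 l z : (4 ^ l.+1)%:R <= enorm z -> layer l z = 0.
Proof.
move=> h; rewrite /layer (strunc_eq j (rho' := (4 ^ l.+1)%:R)) ?subrr //.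
by apply: le_trans h; rewrite ler_nat leq_exp2l.
Qed.

Let layer_lip l z z' : `|layer l z - layer l z'| <=
  2 * (d.+2%:R * enorm (z - z') / (4 ^ l)%:R ^+ d.+1).
Proof.
have -> : layer l z - layer l z' =
  (strunc j (4 ^ l)%:R z - strunc j (4 ^ l)%:R z') -
  (strunc j (4 ^ l.+1)%:R z - strunc j (4 ^ l.+1)%:R z') by rewrite /layer; ring.
apply: le_trans (ler_normB _ _) _; rewrite mulr_natl mulr2n; apply: lerD.
  by apply: strunc_lip => //; rewrite le_max lexx orbT.
by apply: strunc_lip => //; rewrite le_max ler_nat leq_exp2l ?leqnSn ?orbT.
Qed.

Definition torus_kernel l (x : G) : R :=
  if (l < J)%N then layer l (lift_vec x) else 0.

Lemma torus_kernel_odd l x : torus_kernel l (- x) = - torus_kernel l x.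
Proof.
rewrite /torus_kernel; case: ifP => _; last by rewrite oppr0.
have -> : lift_vec (- x) = - lift_vec x.
  by apply/rowP => i; rewrite !mxE centeredN rmorphN.
by rewrite /layer !struncN opprB opprK addrC.
Qed.

Let layer_coord l (z : 'rV[R]_d) i : (4 ^ l.+1)%:R <= `|z 0 i| -> layer l z = 0.
Proof. by move=> h; apply: layer_eq0; apply: le_trans (coord_le_enorm z i). Qed.

Lemma torus_kernel_supp l x : torus_kernel l x != 0 -> (tnorm x <= 4 ^ l.+1)%N.
Proof.
apply: contraNT; rewrite -ltnNge => h; rewrite /torus_kernel; case: ifP => // _.
apply/eqP; have /existsP[i hi] : [exists i, (4 ^ l.+1 < `|centered (x 0%R i)|)%N].
  rewrite -[X in is_true X]negbK negb_exists; apply/negP => /forallP hall.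
  move: h; rewrite ltnNge => /negP; apply; apply/tnorm_leP => i.
  by rewrite leqNgt.
apply: (@layer_coord _ _ i).
by rewrite mxE -intr_norm -abszE -pmulrn ler_nat ltnW.
Qed.

Definition torus_lip : R := 2 * d.+2%:R * d%:R * 3 ^+ d.

(** Wrapping around is harmless: layers are supported in |z| <= 4^J = m / 2.  If
    x and y both lie in the support their lifts differ by the lift of x - y; if
    only one does, say x, the layer also vanishes at lift x - lift (x - y),
    which is either the lift of y or has a coordinate larger than m. *)
Lemma torus_kernel_lip l x y :
  `|torus_kernel l x - torus_kernel l y| <= torus_lip * (tnorm (x - y))%:R /
    ((4 ^ l)%:R * (vol (@tnorm m d) (4 ^ l))%:R).
Proof.
have v0 : 0 < (vol (@tnorm m d) (4 ^ l))%:R :> R.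
  by rewrite ltr0n vol_gt0 // tnorm0.
have rhs0 : 0 <= torus_lip * (tnorm (x - y))%:R /
    ((4 ^ l)%:R * (vol (@tnorm m d) (4 ^ l))%:R).
  by rewrite divr_ge0 ?mulr_ge0 // /torus_lip ?mulr_ge0 // exprn_ge0.
have [lJ|lJ] := boolP (l < J)%N; last first.
  by rewrite /torus_kernel (negbTE lJ) subrr normr0.
have lm : (2 * 4 ^ l.+1 <= m)%N by rewrite leq_mul2l leq_exp2l.
have main z z' : enorm (z - z') <= d%:R * (tnorm (x - y))%:R ->
    `|layer l z - layer l z'| <= torus_lip * (tnorm (x - y))%:R /
    ((4 ^ l)%:R * (vol (@tnorm m d) (4 ^ l))%:R).
  move=> hz; apply: le_trans (layer_lip _ _ _) _.
  apply: (@le_trans _ _ (2 * (d.+2%:R * (d%:R * (tnorm (x - y))%:R) / (4 ^ l)%:R ^+ d.+1))).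
    rewrite ler_wpM2l // ler_wpM2r ?invr_ge0 ?exprn_ge0 ?(ltW (p4_gt0 _)) //.
    by rewrite ler_wpM2l.
  have hv : (vol (@tnorm m d) (4 ^ l))%:R <= 3 ^+ d * (4 ^ l)%:R ^+ d :> R.
    rewrite -exprMn -natrM -natrX ler_nat; apply: leq_trans (vol_tnorm_le _ _ _) _.
    have : (0 < 4 ^ l)%N by rewrite expn_gt0.
    by case: (d) => // d' h; rewrite leq_exp2r //; lia.
  rewrite ler_pdivlMr ?mulr_gt0 //.
  apply: (@le_trans _ _ (2 * (d.+2%:R * (d%:R * (tnorm (x - y))%:R) / (4 ^ l)%:R ^+ d.+1) *
      ((4 ^ l)%:R * (3 ^+ d * (4 ^ l)%:R ^+ d)))).
    rewrite ler_wpM2l ?ler_wpM2l // !mulr_ge0 // invr_ge0 exprn_ge0 //.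
  rewrite le_eqVlt; apply/orP; left; apply/eqP; rewrite /torus_lip exprS.
  by field; rewrite expf_neq0 gt_eqF.
rewrite /torus_kernel lJ.
have liftsub (u v : G) : (tnorm u <= 4 ^ l.+1)%N -> (tnorm v <= 4 ^ l.+1)%N ->
    lift_vec u - lift_vec v = lift_vec (u - v).
  move=> hu hv; apply/rowP => i; rewrite !mxE centeredB ?rmorphB //.
  apply: leq_trans lm; rewrite [X in (_ <= X)%N]mul2n -[X in (_ <= X)%N]addnn.
  by rewrite leq_add // (leq_trans (coord_le_tnorm _ _)).
have zero_far (u : G) : (4 ^ l.+1 < tnorm u)%N -> layer l (lift_vec u) = 0.
  move=> h; apply/eqP; apply: contraTT h => h.
  by rewrite -leqNgt; apply: torus_kernel_supp; rewrite /torus_kernel lJ.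
have mixed (u v : G) : (4 ^ l.+1 < tnorm v)%N ->
    layer l (lift_vec u - lift_vec (u - v)) = 0.
  move=> hv; have [/forallP hall|] :=
      boolP [forall i, (`|(centered (u 0%R i) - centered ((u - v)%R 0%R i))%R| <= m)%N].
    suff -> : lift_vec u - lift_vec (u - v) = lift_vec v by exact: zero_far.
    apply/rowP => i; rewrite !mxE -rmorphB /=; congr (_%:~R).
    rewrite -[RHS](residueK (m := m)); last exact: centered_le.
    rewrite centeredK; have := hall i; rewrite !mxE => /residueK <-.
    by congr centered; rewrite residueB !centeredK subKr.
  rewrite negb_forall => hex; have {hex}/existsP[i hi] := hex.
  rewrite -ltnNge in hi.
  apply: (@layer_coord _ _ i).
  rewrite !mxE -rmorphB -intr_norm -abszE -pmulrn ler_nat.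
  rewrite !mxE in hi; apply: leq_trans (ltnW hi).
  by apply: leq_trans lm; rewrite leq_pmull.
have dist_eq (u v : G) : lift_vec u - (lift_vec u - lift_vec (u - v)) = lift_vec (u - v).
  by rewrite subKr.
have [hx|hx] := leqP (tnorm x) (4 ^ l.+1); have [hy|hy] := leqP (tnorm y) (4 ^ l.+1).
- by apply: main; rewrite liftsub //; exact: enorm_lift_le.
- rewrite (zero_far _ hy) -(mixed x y hy); apply: main.
  by rewrite dist_eq; exact: enorm_lift_le.
- rewrite (zero_far _ hx) distrC -(mixed y x hx); apply: main.
  rewrite dist_eq; apply: le_trans (enorm_lift_le _) _.
  by rewrite -[(y - x)]opprB tnormN.
- by rewrite (zero_far _ hx) (zero_far _ hy) subrr normr0.
Qed.

Lemma torus_kernel_sum i x : (i <= J)%N ->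
  \sum_(i <= l < J) torus_kernel l x =
  strunc j (4 ^ i)%:R (lift_vec x) - strunc j (4 ^ J)%:R (lift_vec x).
Proof.
move=> iJ; rewrite big_nat.
under eq_bigr => l /andP[_ lJ] do rewrite /torus_kernel lJ /layer -opprB.
by rewrite -big_nat sumrN (telescope_sumr (fun l => strunc j (4 ^ l)%:R _)) // opprB.
Qed.

End TorusKernel.

Theorem torus_maximal_weak_type (R : realType) (d : nat) :
  exists2 C : R, 0 <= C & forall J (j : 'I_d)
    (f : 'rV['I_((2 * 4 ^ J).*2.+1)]_d -> R) (S : {set 'rV['I_((2 * 4 ^ J).*2.+1)]_d}),
    (forall q, q \in S -> exists2 i, (i <= J)%N &
      1 < `|\sum_b f b * (strunc j (4 ^ i)%:R (lift_vec R (q - b)) -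
                          strunc j (4 ^ J)%:R (lift_vec R (q - b)))|) ->
    #|S|%:R <= C * \sum_b `|f b|.
Proof.
have A0 : 0 <= torus_lip R d by rewrite !mulr_ge0 // exprn_ge0.
have H J j f S := @discrete_maximal_weak_type R _ _
  (@tnorm0 (2 * 4 ^ J)%N d) (@tnormN _ _) (@tnormD _ _) _ (@vol_tnorm_doubling _ _)
  _ _ A0 (@torus_kernel_odd R d J j) (@torus_kernel_supp R d J j)
  (@torus_kernel_lip R d J j) J f S.
set C := weak_type_const _ _ in H.
exists (Num.max 0 C); first by rewrite le_max lexx.
move=> J j f S hS; apply: (@le_trans _ _ (C * \sum_b `|f b|)).
  apply: H => q /hS[i iJ hi]; exists i => //.
  move: hi; congr (_ < `|_|); apply: eq_bigr => b _.
  by rewrite torus_kernel_sum.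
by rewrite ler_wpM2r ?sumr_ge0 // le_max lexx orbT.
Qed.

(** * Counting lattice cells *)
Section DyadicSum.
Variables (R : realType) (d : nat) (p : R).
Hypothesis dp : d%:R < p.

Definition dyadic_const : R := 8 ^+ d / (1 - 2 `^ (d%:R - p)).

Let theta : R := 2 `^ (d%:R - p).

Let theta_lt1 : theta < 1.
Proof.
have r0 : 0 < p - d%:R by rewrite subr_gt0.
rewrite /theta -opprB powRN invf_lt1 ?powR_gt0 //.
suff : (1 : R) `^ (p - d%:R) < 2 `^ (p - d%:R) by rewrite powR1.
by apply: gt0_ltr_powR; rewrite ?nnegrE ?ltr1n.
Qed.

Let theta_ge0 : 0 <= theta. Proof. exact: powR_ge0. Qed.

Lemma dyadic_const_ge0 : 0 <= dyadic_const.
Proof. by rewrite divr_ge0 ?exprn_ge0 // subr_ge0 ltW. Qed.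

Let geometric L : \sum_(0 <= l < L) theta ^+ l <= (1 - theta)^-1.
Proof.
have t0 : 0 < 1 - theta by rewrite subr_gt0.
rewrite -[leRHS]mulr1 -ler_pdivrMl ?invr_gt0 // invrK.
have -> : (1 - theta) * \sum_(0 <= l < L) theta ^+ l = 1 - theta ^+ L.
  by rewrite big_mkord -opprB mulNr -subrX1 opprB.
by rewrite gerBl exprn_ge0.
Qed.

(** Cut according to 2^l <= rho i < 2^(l+1); the l-th piece is at most
    A 8^d 2^{l(d - p)}. *)
Lemma dyadic_sum (I : finType) (w : I -> R) (rho : I -> nat) (A : R) :
    (forall i, 0 <= w i) ->
    (forall r, \sum_(i | (rho i <= r)%N) w i <= A * (r.*2.+1)%:R ^+ d) ->
  \sum_(i | (0 < rho i)%N) w i * ((rho i)%:R `^ p)^-1 <= A * dyadic_const.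
Proof.
move=> w0 wA.
have A0 : 0 <= A.
  have := wA 0%N; rewrite expr1n mulr1; apply: le_trans.
  exact: sumr_ge0.
pose L := (\max_i rho i).+1.
have p0 : 0 < p by apply: le_lt_trans dp.
apply: (@le_trans _ _ (\sum_(0 <= l < L) ((2 ^+ l) `^ p)^-1 *
    \sum_(i | (rho i <= 2 ^ l.+1)%N) w i)).
  rewrite (eq_bigr (fun l => \sum_i ((2 ^+ l) `^ p)^-1 *
      (if (rho i <= 2 ^ l.+1)%N then w i else 0))); last first.
    by move=> l _; rewrite -mulr_sumr -big_mkcond.
  rewrite exchange_big /= big_mkcond; apply: ler_sum => i _.
  have nonneg l : 0 <= ((2 ^+ l) `^ p)^-1 * (if (rho i <= 2 ^ l.+1)%N then w i else 0).
    by rewrite mulr_ge0 ?invr_ge0 ?powR_ge0 //; case: ifP.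
  case: ifPn => [i0|_]; last by rewrite sumr_ge0.
  pose l := trunc_log 2 (rho i).
  have /andP[l1 l2] : (2 ^ l <= rho i < 2 ^ l.+1)%N by exact: trunc_log_bounds.
  have lL : (l < L)%N.
    rewrite ltnS (leq_trans _ (leq_bigmax i)) //.
    by apply: leq_trans l1; rewrite ltnW // ltn_expl.
  rewrite big_mkord (bigD1 (Ordinal lL)) //= (ltnW l2).
  rewrite -[leLHS]addr0; apply: lerD; last by rewrite sumr_ge0.
  rewrite mulrC ler_wpM2r // lef_pV2 ?posrE ?powR_gt0 ?exprn_gt0 ?ltr0n //.
  by rewrite ge0_ler_powR ?nnegrE ?(ltW p0) // -natrX ler_nat.
apply: (@le_trans _ _ (\sum_(0 <= l < L) A * 8 ^+ d * theta ^+ l)).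
  apply: ler_sum => l _.
  apply: le_trans (ler_wpM2l _ (wA _)) _; first by rewrite invr_ge0 powR_ge0.
  have -> : theta ^+ l = (2 ^+ l) ^+ d * ((2 ^+ l) `^ p)^-1 :> R.
    have q0 : 0 <= 2 ^+ l :> R by rewrite exprn_ge0.
    rewrite -(powR_mulrn d q0) -powRN -powRD; last first.
      by rewrite expf_eq0 pnatr_eq0 andbF implybT.
    by rewrite -(powR_mulrn l theta_ge0) /theta -powRrM mulrC powRrM powR_mulrn.
  rewrite mulrC -!mulrA ler_wpM2l // mulrA ler_wpM2r ?invr_ge0 ?powR_ge0 //.
  rewrite -exprMn lerXn2r ?nnegrE // -?natrX -?natrM ?ler_nat //.
  by have : (0 < 2 ^ l)%N; [rewrite expn_gt0 | rewrite expnS; lia].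
rewrite -mulr_sumr /dyadic_const -!mulrA ler_wpM2l // ler_wpM2l ?exprn_ge0 //.
Qed.

End DyadicSum.

Section Fibers.
Variables (V : zmodType) (I B : finType) (beta : I -> B).

Lemma sum_fibers (P : pred B) (h : I -> B -> V) :
  \sum_(b | P b) \sum_(i | beta i == b) h i b = \sum_(i | P (beta i)) h i (beta i).
Proof.
rewrite (exchange_big_dep (fun i => P (beta i))) /=; last first.
  by move=> b i Pb /eqP ->.
apply: eq_bigr => i Pi; rewrite (big_pred1 (beta i)) // => b /=.
rewrite eq_sym; case: eqP => [->|]; by rewrite ?Pi ?andbF.
Qed.

End Fibers.

Section Lattice.
Variables (R : realType) (d : nat).

Definition floor_vec (x : 'rV[R]_d) : 'rV[int]_d := \row_k Num.floor (x 0 k).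

Definition int_vec (z : 'rV[int]_d) : 'rV[R]_d := \row_k (z 0 k)%:~R.

Lemma floor_dist (x y : R) : `|x - y - (Num.floor x - Num.floor y)%:~R| <= 1.
Proof.
have := floor_itv x; have := floor_itv y; rewrite !intrD intrN.
move: (Num.floor x)%:~R (Num.floor y)%:~R => a b /andP[h1 h2] /andP[h3 h4].
by rewrite ler_norml; apply/andP; split; move: h1 h2 h3 h4; lra.
Qed.

Lemma enorm_floor_vec (x : 'rV[R]_d) : enorm (x - int_vec (floor_vec x)) <= d%:R.
Proof.
rewrite -[leRHS]mulr1; apply: enorm_le_const => k; rewrite !mxE.
have := floor_itv (x 0 k); rewrite intrD; move: (Num.floor _)%:~R => a /andP[h1 h2].
by rewrite ler_norml; apply/andP; split; move: h1 h2; lra.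
Qed.

Lemma enorm_floor_dist (x y : 'rV[R]_d) :
  enorm (x - y - int_vec (floor_vec x - floor_vec y)) <= d%:R.
Proof.
rewrite -[leRHS]mulr1; apply: enorm_le_const => k; rewrite !mxE.
exact: floor_dist.
Qed.

End Lattice.

Definition riesz_sum (R : realType) (d : nat) (s : R) (N : nat) (v : 'I_N -> R)
    (a : 'I_N -> 'rV[R]_d) (j : 'I_d) (eps : R) (x : 'rV[R]_d) : R :=
  \sum_(i | eps < enorm (a i - x)) v i * riesz_kernel s (a i - x) 0 j.

Section Embedding.
Variables (R : realType) (d J : nat) (j : 'I_d).
Let m := (2 * 4 ^ J)%N.

Definition embed (z : 'rV[int]_d) : 'rV['I_(m.*2.+1)]_d :=
  \row_k residue m (z 0 k).

Definition in_box (L : nat) (z : 'rV[int]_d) := forall k, (`|z 0%R k| <= L)%N.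

Lemma lift_embedB q b : in_box (4 ^ J) q -> in_box (4 ^ J) b ->
  lift_vec R (embed q - embed b) = int_vec R (q - b).
Proof.
move=> hq hb; apply/rowP => k; rewrite !mxE -residueB residueK //.
have := hq k; have := hb k; rewrite /m.
by set A := (4 ^ J)%N; lia.
Qed.

Lemma embed_inj q b : in_box (4 ^ J) q -> in_box (4 ^ J) b ->
  embed q = embed b -> q = b.
Proof.
move=> hq hb /rowP qb; apply/rowP => k.
have := qb k; rewrite !mxE => h.
have mm : (4 ^ J <= m)%N by rewrite leq_pmull.
rewrite -[LHS](residueK (m := m)) ?h ?residueK //.
- exact: leq_trans (hb k) mm.
- exact: leq_trans (hq k) mm.
Qed.

Lemma tnorm_attained (x : 'rV['I_(m.*2.+1)]_d) :
  exists k, tnorm x = `|centered (x 0%R k)|%N.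
Proof.
have d0 : (0 < #|'I_d|)%N by apply/card_gt0P; exists j.
by have [k hk] := bigop.eq_bigmax (fun k => `|centered (x 0%R k)|%N) d0; exists k.
Qed.

(** Torus distance between cells compared with the Euclidean distance between
    points of these cells. *)
Section Pair.
Variables (x a : 'rV[R]_d).
Hypothesis boxx : in_box (4 ^ J) (floor_vec x).
Hypothesis boxa : in_box (4 ^ J) (floor_vec a).
Let b := floor_vec a.
Let q := floor_vec x.
Let T := tnorm (embed b - embed q).

Let coord k : (centered ((embed b - embed q) 0 k))%:~R = (int_vec R (b - q)) 0 k :> R.
Proof. by rewrite -lift_embedB // [RHS]mxE. Qed.

Lemma tnorm_le_lattice : T%:R <= enorm (int_vec R (b - q)).
Proof.
have [k hk] := tnorm_attained (embed b - embed q).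
apply: le_trans (coord_le_enorm _ k); rewrite -coord -intr_norm -abszE -pmulrn.
by rewrite /T hk.
Qed.

Lemma tnorm_le_enorm : T%:R - 1 <= enorm (a - x).
Proof.
have [k hk] := tnorm_attained (embed b - embed q).
apply: le_trans (coord_le_enorm _ k).
have TE : T%:R = `|(int_vec R (b - q)) 0 k| by rewrite -coord -intr_norm -abszE -pmulrn /T hk.
have := floor_dist (a 0 k) (x 0 k).
have : (int_vec R (b - q)) 0 k = (Num.floor (a 0 k) - Num.floor (x 0 k))%:~R by rewrite !mxE.
rewrite TE; move: (int_vec _ _ _ _) => z <-.
rewrite !mxE; set y := a 0 k - x 0 k => h.
by have := ler_distD y z 0; rewrite !subr0 distrC; lra.
Qed.

Lemma enorm_le_tnorm : enorm (a - x) <= d%:R * (T.+1)%:R.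
Proof.
have h : enorm (int_vec R (b - q)) <= d%:R * T%:R.
  by rewrite -lift_embedB //; exact: enorm_lift_le.
have := enorm_floor_dist a x; rewrite -/b -/q => h2.
rewrite -[a - x](subrK (int_vec R (b - q))); apply: le_trans (enormD _ _) _.
by rewrite -natr1 mulrDr mulr1 addrC lerD.
Qed.

End Pair.
End Embedding.

Section Kernel.
Variables (R : realType) (d : nat) (s : R).

Lemma riesz_kernel_le (z : 'rV[R]_d) (j : 'I_d) (t : R) : 0 <= s -> 0 < t -> t <= enorm z ->
  `|riesz_kernel s z 0 j| <= (t `^ s)^-1.
Proof.
move=> s0 t0 tz; have z0 : 0 < enorm z by exact: lt_le_trans tz.
rewrite mxE normrM ger0_norm ?invr_ge0 ?powR_ge0 //.
rewrite powRD; last by rewrite (gt_eqF z0) implybT.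
rewrite powRr1 ?(ltW z0) // invfM -mulrA.
apply: (@le_trans _ _ ((enorm z `^ s)^-1 * 1)).
  rewrite ler_wpM2l ?invr_ge0 ?powR_ge0 // ler_pdivrMl // mulr1.
  exact: coord_le_enorm.
rewrite mulr1 lef_pV2 ?posrE ?powR_gt0 //.
by apply: ge0_ler_powR => //; rewrite nnegrE ltW.
Qed.

Lemma riesz_kernel_strunc (z : 'rV[R]_d) (j : 'I_d) rho : 0 < enorm z -> rho <= enorm z ->
  riesz_kernel d%:R z 0 j = strunc j rho z.
Proof.
move=> z0 rz; rewrite mxE /strunc max_l // natr1 powR_mulrn ?(ltW z0) //.
by rewrite mulrC.
Qed.

End Kernel.

Lemma absz_sub_le (u w : int) L : (`|u| <= L)%N -> (`|w| <= L)%N ->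
  (`|(u - w)%R| <= L.*2)%N.
Proof. lia. Qed.

(** S lists cells and [cells] is its image in the torus; L bounds all the
    coordinates in play and J is so large that the embedding of the relevant
    cells is faithful and, in the critical case, that no charge is further than
    4^J from a bad point. *)
Section BadCells.
Variables (R : realType) (d : nat) (N : nat) (v : 'I_N -> R) (a : 'I_N -> 'rV[R]_d).
Variables (j : 'I_d) (S : seq 'rV[int]_d) (J L : nat).
Hypothesis S_uniq : uniq S.
Hypothesis S_box : forall q, q \in S -> in_box L q.
Hypothesis a_box : forall i, in_box L (floor_vec (a i)).
Hypothesis LJ : (d * (L.*2.+1) <= 4 ^ J)%N.
Let m := (2 * 4 ^ J)%N.
Notation G := 'rV['I_(m.*2.+1)]_d.

Let Lbox (z : 'rV[int]_d) : in_box L z -> in_box (4 ^ J) z.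
Proof.
move=> h k; apply: leq_trans (h k) _; apply: leq_trans LJ.
by case: (d) j => [[]//|d' _]; rewrite mulSn; lia.
Qed.

Let beta i : G := embed J (floor_vec (a i)).
Let cells : {set G} := [set y in map (embed J) S].
Let near : {set G} := [set y | [exists i, (tnorm (beta i - y) <= 2)%N]].

Lemma card_cells : #|cells| = size S.
Proof.
rewrite /cells cardsE (card_uniqP _) ?size_map // map_inj_in_uniq //.
by move=> q b qS bS; apply: embed_inj; apply: Lbox; exact: S_box.
Qed.

Lemma card_near : (#|near| <= N * 5 ^ d)%N.
Proof.
apply: (@leq_trans (\sum_(i < N) #|[set y | (tnorm (y - beta i) <= 2)%N]|)).
  rewrite -sum1_card.
  apply: (@leq_trans (\sum_(y : G) \sum_(i < N) (tnorm (y - beta i)%R <= 2))%N).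
    rewrite big_mkcond; apply: leq_sum => y _.
    rewrite inE; case: ifP => // hex; have /existsP[i hi] := hex.
    by rewrite (bigD1 i) //= -opprB tnormN hi leq_addr.
  rewrite exchange_big; apply: leq_sum => i _.
  rewrite -sum1dep_card [X in (_ <= X)%N]big_mkcond.
  by apply: leq_sum => y _ /=; case: (tnorm _ <= _)%N.
rewrite (eq_bigr (fun=> vol (@tnorm m d) 2)) => [|i _]; last exact: card_ball.
by rewrite sum_nat_const card_ord leq_mul2l (vol_tnorm_le _ _ 2) orbT.
Qed.

Let T (y : G) i := tnorm (beta i - y).

Let far_T y i : y \notin near -> (2 < T y i)%N.
Proof.
by rewrite inE => /existsPn/(_ i); rewrite -ltnNge.
Qed.

Let sum_T_le (y : G) (w : 'I_N -> R) (r : nat) :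
  \sum_(b | (tnorm (b - y)%R <= r)%N) \sum_(i | beta i == b) w i =
  \sum_(i | (T y i <= r)%N) w i.
Proof. by rewrite (@sum_fibers R _ _ beta (fun b => tnorm (b - y)%R <= r)%N (fun i _ => w i)). Qed.

Section Supercritical.
Variable s : R.
Hypothesis ds : d%:R < s.
Hypothesis S_bad : forall q, q \in S -> exists2 x, floor_vec x = q &
  exists2 eps, 0 < eps & 1 < `|riesz_sum s v a j eps x|.

Lemma card_far_supercritical :
  #|cells :\: near|%:R <= 2 `^ s * dyadic_const d s * \sum_i `|v i|.
Proof.
have s0 : 0 <= s by apply: ltW; apply: le_lt_trans ds.
have key y : y \in cells :\: near -> 1 <= \sum_i `|v i| * (2 `^ s * ((T y i)%:R `^ s)^-1).
  case/setDP; rewrite inE => /mapP[q qS ->] yn.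
  have [x xq [eps eps0 h]] := S_bad qS; apply: le_trans (ltW h) _.
  apply: le_trans (ler_norm_sum _ _ _) _.
  rewrite [leLHS]big_mkcond; apply: ler_sum => i _.
  have t3 := far_T i yn.
  have t0 : 0 < (T (embed J q) i)%:R / 2 :> R by rewrite divr_gt0 // ltr0n (leq_trans _ t3).
  case: ifP => _; last first.
    by rewrite mulr_ge0 // mulr_ge0 ?invr_ge0 ?powR_ge0.
  rewrite normrM ler_wpM2l //.
  have -> : 2 `^ s * ((T (embed J q) i)%:R `^ s)^-1 =
      (((T (embed J q) i)%:R / 2) `^ s)^-1.
    rewrite powRM ?invr_ge0 // invfM mulrC; congr (_ * _).
    by rewrite -powR_inv1 // -powRrM mulN1r powRN invrK.
  apply: riesz_kernel_le => //.
  have := tnorm_le_enorm j (x := x) (a := a i) (J := J); rewrite xq.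
  move=> /(_ (Lbox (S_box qS)) (Lbox (a_box i))); apply: le_trans.
  rewrite -/(beta i) -/(T _ i).
  have : (3 : R) <= (T (embed J q) i)%:R by rewrite ler_nat.
  by move: (T _ _)%:R => t ht; lra.
rewrite -sum1_card natr_sum.
apply: (@le_trans _ _ (\sum_(y in cells :\: near) \sum_i `|v i| * (2 `^ s * ((T y i)%:R `^ s)^-1))).
  exact: ler_sum.
rewrite exchange_big mulr_sumr; apply: ler_sum => i _ /=.
rewrite -mulr_sumr [leRHS]mulrC ler_wpM2l // -mulr_sumr ler_wpM2l ?powR_ge0 //.
apply: (@le_trans _ _ (\sum_(y | (0 < T y i)%N) 1 * ((T y i)%:R `^ s)^-1)).
  rewrite big_mkcond [leRHS]big_mkcond; apply: ler_sum => y _.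
  case: ifP => [/setDP[_ yn]|_]; last first.
    by case: ifP => // _; rewrite mul1r invr_ge0 powR_ge0.
  by rewrite ifT ?mul1r // (leq_trans _ (far_T i yn)).
rewrite -[leRHS]mul1r; apply: (dyadic_sum ds) => // r.
rewrite mul1r -natrX sumr_const ler_nat; apply: leq_trans (vol_tnorm_le m d r).
rewrite -(card_ball (@tnorm m d) (beta i)) eq_leq //.
by apply: eq_card => y; rewrite !inE /T -opprB tnormN.
Qed.

Lemma card_bad_supercritical : (size S)%:R <=
  (5 ^ d)%:R * N%:R + 2 `^ s * dyadic_const d s * \sum_i `|v i|.
Proof.
rewrite -card_cells -(cardsID near cells) natrD lerD //; last first.
  exact: card_far_supercritical.
rewrite -natrM ler_nat mulnC; apply: leq_trans card_near.
exact/subset_leq_card/finset.subsetIr.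
Qed.

End Supercritical.

Section Critical.
Variables (Cmax : R).
Hypothesis Cmax_ge0 : 0 <= Cmax.
Hypothesis maximal : forall (f : G -> R) (U : {set G}),
  (forall q, q \in U -> exists2 i, (i <= J)%N &
      1 < `|\sum_b f b * (strunc j (4 ^ i)%:R (lift_vec R (q - b)) -
                          strunc j (4 ^ J)%:R (lift_vec R (q - b)))|) ->
  #|U|%:R <= Cmax * \sum_b `|f b|.
Hypothesis vJ : 4 * \sum_i `|v i| <= (4 ^ J)%:R.
Hypothesis S_bad : forall q, q \in S -> exists2 x, floor_vec x = q &
  exists2 eps, 0 < eps & 1 < `|riesz_sum d%:R v a j eps x|.

(** The first summand bounds the error made by moving charges and points to the
    lattice and by smoothing the truncation, the second one the charges near
    the truncation sphere. *)
Definition smooth_const : R :=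
  d.+2%:R * d%:R * 2 ^+ d.+1 * dyadic_const d (d.+1%:R : R) + 17 ^+ d.
Let c : R := (4 * (smooth_const + 1))^-1.

Let ddS : d%:R < d.+1%:R :> R. Proof. by rewrite ltr_nat. Qed.

Let smooth_const_ge0 : 0 <= smooth_const.
Proof.
by rewrite addr_ge0 ?exprn_ge0 // mulr_ge0 ?dyadic_const_ge0 // !mulr_ge0 // exprn_ge0.
Qed.

Let c_gt0 : 0 < c.
Proof. by rewrite invr_gt0 mulr_gt0 // ltr_wpDl. Qed.

Let W (b : G) := \sum_(i | beta i == b) `|v i|.
Let F (b : G) := \sum_(i | beta i == b) v i.

(** Cells about which the mass of some ball is large; they are few, and at the
    other cells the errors above are at most c times [smooth_const]. *)
Let dense : {set G} := [set y | `[< exists r, c * (vol (@tnorm m d) r)%:R <=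
   \sum_(b | (tnorm (b - y)%R <= r)%N) W b >]].

Let sum_W : \sum_b W b = \sum_i `|v i|.
Proof. exact: (@sum_fibers R _ _ beta xpredT (fun i _ => `|v i|)). Qed.

Let W_ge0 b : 0 <= W b. Proof. by rewrite sumr_ge0. Qed.

Lemma card_dense : #|dense|%:R <= (3 ^ d)%:R / c * \sum_i `|v i|.
Proof.
have /choice[rho hrho] : forall y, exists r, y \in dense ->
    c * (vol (@tnorm m d) r)%:R <= \sum_(b | (tnorm (b - y)%R <= r)%N) W b.
  move=> y; have [|_] := boolP (y \in dense); last by exists 0%N.
  by rewrite inE => /asboolP[r hr]; exists r.
have := maximal_weak_type (@tnorm0 _ _) (@tnormN _ _) (@tnormD _ _)
  (@vol_tnorm_doubling _ _) W_ge0 (ltW c_gt0) hrho.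
by rewrite sum_W mulrAC ler_pdivlMr // mulrC.
Qed.

Let growth y r : y \notin dense ->
  \sum_(i | (T y i <= r)%N) `|v i| <= c * (r.*2.+1)%:R ^+ d.
Proof.
rewrite inE => /asboolPn hy; rewrite -sum_T_le.
apply: (@le_trans _ _ (c * (vol (@tnorm m d) r)%:R)).
  by apply: ltW; rewrite ltNge; apply/negP => h; apply: hy; exists r.
by rewrite ler_wpM2l ?(ltW c_gt0) // -natrX ler_nat vol_tnorm_le.
Qed.

(** All charges are at distance more than 1 from x, so eps may be replaced by
    max(eps, 1); the exponent i is then determined by 4^i <= eps < 4^(i+1).
    Beyond eps the kernel agrees with its smooth truncation at 4^i, which is
    moved to the lattice by [strunc_lip]; below eps the smooth truncation is at
    most 4^{-id} and the mass at stake is at most c (17 * 4^i)^d. *)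
Let smooth_close q x eps : q \in S -> floor_vec x = q ->
    embed J q \notin near -> embed J q \notin dense -> 0 < eps ->
    1 < `|riesz_sum d%:R v a j eps x| ->
  exists2 i, (i <= J)%N &
    `|riesz_sum d%:R v a j eps x -
      \sum_k v k * strunc j (4 ^ i)%:R (int_vec R (floor_vec (a k) - q))| <= 4^-1.
Proof.
move=> qS xq qn qd eps0 big.
set y := embed J q in qn qd.
have Tq k : (T y k)%:R <= enorm (int_vec R (floor_vec (a k) - q)).
  have := tnorm_le_lattice j (x := x) (a := a k) (J := J); rewrite xq.
  by apply; apply: Lbox => //; exact: S_box.
have Ta k : (T y k)%:R / 2 <= enorm (a k - x).
  have := tnorm_le_enorm j (x := x) (a := a k) (J := J); rewrite xq.
  move=> /(_ (Lbox (S_box qS)) (Lbox (a_box k))); apply: le_trans.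
  have : (3 : R) <= (T y k)%:R by rewrite ler_nat; exact: far_T.
  by rewrite -/(beta k) -/(T _ k); move: (T _ _)%:R => t ht; lra.
have a1 k : 1 < enorm (a k - x).
  apply: lt_le_trans (Ta k); rewrite ltr_pdivlMr // mul1r ltr_nat.
  exact: far_T.
have aJ k : enorm (a k - x) <= (4 ^ J)%:R.
  have := enorm_le_tnorm (x := x) (a := a k) (J := J); rewrite xq.
  move=> /(_ (Lbox (S_box qS)) (Lbox (a_box k))) /le_trans; apply.
  rewrite -natrM ler_nat; apply: leq_trans LJ; rewrite leq_mul2l ltnS.
  apply/orP; right; apply/tnorm_leP => l.
  have := lift_embedB R (Lbox (a_box k)) (Lbox (S_box qS)).
  move=> /rowP/(_ l); rewrite mxE [RHS]mxE => /intr_inj ->.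
  have ha := a_box k l; have hq := S_box qS l; rewrite mxE in ha.
  by rewrite !mxE absz_sub_le.
pose eps' := Num.max eps 1.
have eps'E k : (eps < enorm (a k - x)) = (eps' < enorm (a k - x)).
  by rewrite /eps' gt_max a1 andbT.
have eps'J : eps' < (4 ^ J)%:R.
  rewrite ltNge; apply/negP => h; move: big.
  rewrite /riesz_sum big_pred0 ?normr0 ?ltr10 // => k.
  by apply/negbTE; rewrite eps'E -leNgt (le_trans (aJ k)).
have ex_i : exists i, (4 ^ i)%:R <= eps' by exists 0%N; rewrite /eps' le_max lexx orbT.
have ub_i i : (4 ^ i)%:R <= eps' -> (i <= J)%N.
  move=> h; have := le_lt_trans h eps'J; rewrite ltr_nat ltn_exp2l //; exact: ltnW.
pose i := ex_maxn ex_i ub_i.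
have [i1 i2] : (4 ^ i)%:R <= eps' /\ eps' < (4 ^ i.+1)%:R.
  rewrite /i; case: ex_maxnP => l hl hmax; split=> //.
  by rewrite ltNge; apply/negP => /hmax; rewrite ltnn.
exists i; first exact: (ub_i _ i1).
have p0 : 0 < (4 ^ i)%:R :> R by rewrite ltr0n expn_gt0.
pose X k : R := (d.+2%:R * d%:R * 2 ^+ d.+1) * ((T y k)%:R `^ d.+1%:R)^-1.
pose Y k : R := if (T y k <= 8 * 4 ^ i)%N then ((4 ^ i)%:R ^+ d)^-1 else 0.
have X0 k : 0 <= X k by rewrite mulr_ge0 ?invr_ge0 ?powR_ge0 // mulr_ge0 ?exprn_ge0.
have Y0 k : 0 <= Y k by rewrite /Y; case: ifP => // _; rewrite invr_ge0 exprn_ge0.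
have term k : `|(if eps < enorm (a k - x) then v k * riesz_kernel d%:R (a k - x) 0 j else 0) -
    v k * strunc j (4 ^ i)%:R (int_vec R (floor_vec (a k) - q))| <= `|v k| * (X k + Y k).
  rewrite eps'E; case: ltP => he.
    rewrite (riesz_kernel_strunc j (rho := (4 ^ i)%:R)); first last.
    - by apply: le_trans i1 _; exact: ltW.
    - by apply: lt_trans (a1 k); rewrite ltr01.
    rewrite -mulrBr normrM ler_wpM2l //.
    rewrite -[leLHS]addr0; apply: lerD => //.
    have t0 : 0 < (T y k)%:R / 2 :> R.
      by rewrite divr_gt0 // ltr0n (leq_trans _ (far_T k qn)).
    apply: le_trans (strunc_lip j (t := (T y k)%:R / 2) _ _ _) _ => //.
    - by rewrite le_max Ta.
    - rewrite le_max; apply/orP; left; apply: le_trans (Tq k).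
      by rewrite ler_pdivrMr // ler_peMr // ler1n.
    have -> : X k = d.+2%:R * d%:R / ((T y k)%:R / 2) ^+ d.+1.
      by rewrite /X powR_mulrn // expr_div_n invfM invrK; ring.
    rewrite ler_wpM2r ?invr_ge0 ?exprn_ge0 ?(ltW t0) // ler_wpM2l //.
    by rewrite -xq; exact: enorm_floor_dist.
  rewrite sub0r normrN normrM ler_wpM2l //.
  rewrite -[leLHS]add0r; apply: lerD => //.
  have -> : Y k = ((4 ^ i)%:R ^+ d)^-1.
    rewrite /Y ifT // -(ler_nat R).
    have := le_lt_trans he i2; have := Ta k.
    by rewrite expnS !natrM; move: (enorm _) (T _ _)%:R (4 ^ i)%:R => e t u; lra.
  exact: strunc_bound.
rewrite /riesz_sum [X in X - _]big_mkcond -sumrB.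
apply: le_trans (ler_norm_sum _ _ _) _.
apply: le_trans (ler_sum _ (fun k _ => term k)) _.
under eq_bigr => k _ do rewrite mulrDr.
rewrite big_split /=.
(* c is chosen so that c smooth_const <= 1/4 *)
apply: (@le_trans _ _ (c * smooth_const)); last first.
  by rewrite /c ler_pdivrMl ?mulr_gt0 ?ltr_wpDl //; lra.
rewrite /smooth_const mulrDr; apply: lerD.
  have -> : \sum_k `|v k| * X k = (d.+2%:R * d%:R * 2 ^+ d.+1) *
      \sum_(k | (0 < T y k)%N) `|v k| * ((T y k)%:R `^ d.+1%:R)^-1.
    rewrite [X in _ * X]big_mkcond mulr_sumr; apply: eq_bigr => k _.
    by rewrite ifT ?(leq_trans _ (far_T k qn)) // /X; ring.
  rewrite mulrCA ler_wpM2l ?mulr_ge0 ?exprn_ge0 //.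
  by apply: (dyadic_sum ddS) => // r; exact: growth.
have -> : \sum_k `|v k| * Y k =
    (\sum_(k | (T y k <= 8 * 4 ^ i)%N) `|v k|) * ((4 ^ i)%:R ^+ d)^-1.
  rewrite mulr_suml [RHS]big_mkcond; apply: eq_bigr => k _.
  by rewrite /Y; case: ifP => _; rewrite ?mulr0.
rewrite ler_pdivrMr ?exprn_gt0 //; apply: le_trans (growth _ qd) _.
rewrite -mulrA -exprMn ler_wpM2l ?(ltW c_gt0) //.
rewrite -natrM -!natrX ler_nat.
have h17 (t : nat) : (0 < t)%N -> ((8 * t).*2.+1 <= 17 * t)%N by clear; lia.
by case: (d) => // d'; rewrite leq_exp2r // h17 // expn_gt0.
Qed.

Lemma card_far_critical :
  #|(cells :\: near) :\: dense|%:R <= 2 * Cmax * \sum_i `|v i|.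
Proof.
have FW : \sum_b `|2 * F b| <= 2 * \sum_i `|v i|.
  rewrite -sum_W mulr_sumr; apply: ler_sum => b _.
  by rewrite normrM ger0_norm // ler_wpM2l // ler_norm_sum.
apply: (@le_trans _ _ (Cmax * \sum_b `|2 * F b|)); last first.
  by rewrite [2 * Cmax]mulrC -mulrA ler_wpM2l.
apply: maximal => y /setDP[/setDP[]]; rewrite inE => /mapP[q qS ->] yn yd.
have [x xq [eps eps0 big]] := S_bad qS.
have [i iJ hi] := smooth_close qS xq yn yd eps0 big; exists i => //.
have Jle : `|\sum_k v k * strunc j (4 ^ J)%:R (int_vec R (floor_vec (a k) - q))| <= 4^-1.
  have p0 : 0 < (4 ^ J)%:R :> R by rewrite ltr0n expn_gt0.
  apply: le_trans (ler_norm_sum _ _ _) _.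
  apply: (@le_trans _ _ (\sum_k `|v k| * ((4 ^ J)%:R ^+ d)^-1)).
    by apply: ler_sum => k _; rewrite normrM ler_wpM2l // strunc_bound.
  rewrite -mulr_suml ler_pdivrMr ?exprn_gt0 // ler_pdivlMl //.
  apply: le_trans vJ _; case: (d) j => [[]//|d' _].
  by rewrite exprS ler_peMr ?exprn_ege1 ?ler1n ?expn_gt0 ?(ltW p0).
have -> : \sum_b 2 * F b * (strunc j (4 ^ i)%:R (lift_vec R (embed J q - b)) -
                          strunc j (4 ^ J)%:R (lift_vec R (embed J q - b))) =
   - (2 * (\sum_k v k * strunc j (4 ^ i)%:R (int_vec R (floor_vec (a k) - q)) -
      \sum_k v k * strunc j (4 ^ J)%:R (int_vec R (floor_vec (a k) - q)))).
  under eq_bigr => b _ do rewrite /F mulr_sumr mulr_suml.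
  rewrite (@sum_fibers R _ _ beta xpredT) /=.
  rewrite -sumrB mulr_sumr -sumrN; apply: eq_bigr => k _.
  rewrite -(lift_embedB R (Lbox (a_box k)) (Lbox (S_box qS))) -/(beta k).
  have -> : lift_vec R (embed J q - beta k) = - lift_vec R (beta k - embed J q).
    by apply/rowP => l; rewrite -opprB !mxE -opprB centeredN rmorphN.
  by rewrite !struncN; ring.
rewrite normrN normrM ger0_norm //.
move: hi Jle big; set P := riesz_sum _ _ _ _ _ _; set A := \sum_k _; set B := \sum_k _.
move=> h1 h2 h3.
have := ler_normD (P - A) (A - B + B); rewrite [A - B + B]subrK subrK.
have := ler_normD (A - B) B; rewrite subrK.
by lra.
Qed.

Lemma card_bad_critical : (size S)%:R <= (5 ^ d)%:R * N%:R +
  ((3 ^ d)%:R * (4 * (smooth_const + 1)) + 2 * Cmax) * \sum_i `|v i|.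
Proof.
rewrite -card_cells -(cardsID near cells) natrD lerD //.
  rewrite -natrM ler_nat mulnC; apply: leq_trans card_near.
  exact/subset_leq_card/finset.subsetIr.
rewrite -(cardsID dense (cells :\: near)) natrD mulrDl lerD //.
  apply: (@le_trans _ _ #|dense|%:R); last by have := card_dense; rewrite /c invrK.
  by rewrite ler_nat; exact/subset_leq_card/finset.subsetIr.
exact: card_far_critical.
Qed.

End Critical.

End BadCells.

(** The weights enter through their total mass only, which allows the threshold
    to be normalised to 1. *)
Theorem card_bad_cells (R : realType) (d : nat) (s : R) : d%:R <= s ->
  exists2 C : R, 0 <= C &
    forall (N : nat) (v : 'I_N -> R) (a : 'I_N -> 'rV[R]_d) (j : 'I_d)
      (S : seq 'rV[int]_d), uniq S ->
      (forall q, q \in S -> exists2 x, floor_vec x = q &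
        exists2 eps, 0 < eps & 1 < `|riesz_sum s v a j eps x|) ->
    (size S)%:R <= C * (N%:R + \sum_i `|v i|).
Proof.
rewrite le_eqVlt => ds.
suff [C1 [C2 [C1_ge0 C2_ge0 H]]] : exists C1 C2 : R, [/\ 0 <= C1, 0 <= C2 &
    forall (N : nat) (v : 'I_N -> R) (a : 'I_N -> 'rV[R]_d) (j : 'I_d)
      (S : seq 'rV[int]_d) (J L : nat), uniq S ->
      (forall q, q \in S -> exists2 x, floor_vec x = q &
        exists2 eps, 0 < eps & 1 < `|riesz_sum s v a j eps x|) ->
      (forall q, q \in S -> in_box L q) ->
      (forall i, in_box L (floor_vec (a i))) ->
      (d * (L.*2.+1) <= 4 ^ J)%N -> 4 * \sum_i `|v i| <= (4 ^ J)%:R ->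
    (size S)%:R <= C1 * N%:R + C2 * \sum_i `|v i|].
  exists (C1 + C2); first exact: addr_ge0.
  move=> N v a j S S_uniq S_bad.
  (* 4^J exceeds J, hence both quantities it has to exceed *)
  pose LS := \max_(q <- S) \max_(k < d) `|q 0%R k|%N.
  pose La := \max_(i < N) \max_(k < d) `|floor_vec (a i) 0%R k|%N.
  pose L := maxn LS La.
  pose J := maxn (d * L.*2.+1) (Num.bound (4 * \sum_i `|v i|)).
  have v0 : 0 <= \sum_i `|v i| by rewrite sumr_ge0.
  apply: le_trans (H N v a j S J L S_uniq S_bad _ _ _ _) _.
  - move=> q qS k; apply: leq_trans (leq_maxl _ _); rewrite /LS.
    by rewrite (big_rem q) //= leq_max leq_bigmax.
  - move=> i k; apply: leq_trans (leq_maxr _ _); rewrite /La.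
    apply: leq_trans (leq_bigmax i).
    exact: leq_bigmax.
  - by apply: (@leq_trans J); [exact: leq_maxl | rewrite ltnW // ltn_expl].
  - apply: le_trans (ltW (archi_boundP _)) _; first by rewrite mulr_ge0.
    rewrite ler_nat; apply: (@leq_trans J); first exact: leq_maxr.
    by rewrite ltnW // ltn_expl.
  - have N0 : 0 <= N%:R :> R by [].
    by move: v0 N0; move: (\sum_i _) N%:R => V n; nra.
have d0 : 0 <= (5 ^ d)%:R :> R by [].
case/orP: ds => [/eqP <-|ds].
  have [Cmax Cmax0 hmax] := torus_maximal_weak_type R d.
  exists (5 ^ d)%:R, ((3 ^ d)%:R * (4 * (smooth_const R d + 1)) + 2 * Cmax); split=> //.
    rewrite addr_ge0 ?mulr_ge0 // addr_ge0 // /smooth_const addr_ge0 ?exprn_ge0 //.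
    by rewrite mulr_ge0 ?dyadic_const_ge0 ?mulr_ge0 ?exprn_ge0 // ltr_nat.
  move=> N v a j S J L S_uniq S_bad S_box a_box dL vJ.
  exact: (card_bad_critical S_uniq S_box a_box dL Cmax0 (hmax J j) vJ S_bad).
exists (5 ^ d)%:R, (2 `^ s * dyadic_const d s); split=> //.
  by rewrite mulr_ge0 ?powR_ge0 ?dyadic_const_ge0.
move=> N v a j S J L S_uniq S_bad S_box a_box dL _.
exact: (card_bad_supercritical S_uniq S_box a_box dL ds S_bad).
Qed.

(** * Integration against combinations of point masses *)
Section FirstIndex.
Variables (T : Type) (N : nat) (a : 'I_N -> T).

(** A canonical index for the point a j; as the points may coincide, masses are
    gathered at canonical indices. *)
Definition first_index (j : 'I_N) : 'I_N := odflt j [pick i | `[< a i = a j >]].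

Lemma first_indexK j : a (first_index j) = a j.
Proof. by rewrite /first_index; case: pickP => //= i /asboolP. Qed.

Lemma first_index_eq i j : (first_index i == first_index j) = `[< a i = a j >].
Proof.
apply/eqP/asboolP => [ij|ij]; first by rewrite -first_indexK ij first_indexK.
rewrite /first_index ij; case: pickP => // /(_ j).
by move/asboolPn => /(_ erefl).
Qed.

Lemma first_index_eqE i j : (first_index i == j) -> forall l, (first_index l == j) = `[< a l = a j >].
Proof.
move=> /eqP ij l; rewrite -first_index_eq; congr (_ == _).
by apply/eqP; rewrite -{1}ij eq_sym first_index_eq; apply/asboolP; rewrite -ij first_indexK.
Qed.

End FirstIndex.

(** The coefficients p may be negative although mu is a measure; gathered at
    canonical indices they become the masses of singletons, hence nonnegative,
    and mu is a combination of Dirac measures. *)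
Section AtomicMeasure.
Local Open Scope classical_set_scope.
Context (disp : measure_display) (T : measurableType disp) (R : realType).
Variables (mu : {measure set T -> \bar R}) (N : nat) (a : 'I_N -> T) (p : 'I_N -> R).
Hypothesis set1_measurable : forall x : T, measurable [set x].
Hypothesis muE : forall A, measurable A ->
  mu A = (\sum_j p j * (\1_A (a j)))%:E.

Let P j : R := \sum_(i | first_index a i == j) p i.

Let P_ge0 j : 0 <= P j.
Proof.
rewrite /P; have [i ij|none] := pickP (fun i => first_index a i == j); last first.
  by rewrite big_pred0.
have : (0 <= mu [set a j])%E by exact: measure_ge0.
rewrite muE // lee_fin => /le_trans; apply.
rewrite le_eqVlt; apply/orP; left; apply/eqP.
rewrite [RHS]big_mkcond; apply: eq_bigr => l _.
rewrite (first_index_eqE ij) indicE; case: asboolP => h.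
  by rewrite mem_set ?mulr1.
by rewrite memNset ?mulr0.
Qed.

Let sum_P (g : T -> R) : \sum_j P j * g (a j) = \sum_j p j * g (a j).
Proof.
have -> : \sum_j P j * g (a j) = \sum_j \sum_(i | first_index a i == j) p i * g (a j).
  by apply: eq_bigr => j _; rewrite mulr_suml.
rewrite (sum_fibers (first_index a) xpredT (fun i j => p i * g (a j))) /=.
by apply: eq_bigr => i _; rewrite first_indexK.
Qed.

Let atom (n : nat) : T := if insub n is Some i then a i else point.
Let weight (n : nat) : {nonneg R} :=
  if insub n is Some i then NngNum (P_ge0 i) else 0%:nng.
Let atoms (n : nat) : {measure set T -> \bar R} := mscale (weight n) (dirac (atom n)).

Let muE' A : measurable A -> mu A = msum atoms N A.
Proof.
move=> mA; rewrite muE // /msum -sum_P -sumEFin; apply: eq_bigr => i _.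
by rewrite /atoms /mscale /= /weight /atom valK /= EFinM indicE.
Qed.

Lemma integral_atomic_ge0 (D : set T) (f : T -> \bar R) : measurable D ->
    measurable_fun D f -> (forall x, D x -> (0 <= f x)%E) ->
  (\int[mu]_(x in D) f x = \sum_j (P j)%:E * ((\1_D (a j) : R)%:E * f (a j)))%E.
Proof.
move=> mD mf f0; rewrite (eq_measure_integral (msum atoms N)); last first.
  by move=> A mA _; exact: muE'.
rewrite ge0_integral_measure_sum //; apply: eq_bigr => i _.
rewrite ge0_integral_mscale // integral_dirac //.
by rewrite /weight /atom valK /= indicE.
Qed.

Lemma Rintegral_atomic (D : set T) (f : T -> R) : measurable D ->
    measurable_fun D f ->
  Rintegral mu D f = \sum_j p j * (\1_D (a j) * f (a j)).
Proof.
move=> mD mf; have mEf : measurable_fun D (EFin \o f) by exact/measurable_EFinP.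
rewrite /Rintegral integralE.
rewrite (integral_atomic_ge0 mD (measurable_funepos mEf)); last first.
  by move=> x _; exact: funepos_ge0.
rewrite (integral_atomic_ge0 mD (measurable_funeneg mEf)); last first.
  by move=> x _; exact: funeneg_ge0.
have -> : (\sum_j (P j)%:E * ((\1_D (a j) : R)%:E * (EFin \o f)^\+ (a j)) =
    (\sum_j P j * (\1_D (a j) * Num.max (f (a j)) 0))%:E)%E.
  by rewrite -sumEFin; apply: eq_bigr => j _; rewrite funeposE /= -EFin_max !EFinM.
have -> : (\sum_j (P j)%:E * ((\1_D (a j) : R)%:E * (EFin \o f)^\- (a j)) =
    (\sum_j P j * (\1_D (a j) * Num.max (- f (a j)) 0))%:E)%E.
  by rewrite -sumEFin; apply: eq_bigr => j _; rewrite funenegE /= -EFin_max !EFinM.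
rewrite -EFinB /= -sumrB -(sum_P (fun x => \1_D x * f x)).
apply: eq_bigr => j _; rewrite -!mulrBr; congr (_ * (_ * _)).
by rewrite /Num.max; case: ltP => h1; case: ltP => h2; lra.
Qed.

End AtomicMeasure.

Section AtomicCharge.
Local Open Scope classical_set_scope.
Context (disp : measure_display) (T : measurableType disp) (R : realType).
Variables (nu : {charge set T -> \bar R}) (N : nat) (a : 'I_N -> T) (w : 'I_N -> R).
Hypothesis set1_measurable : forall x : T, measurable [set x].
Hypothesis nuE : forall A, measurable A -> nu A = (\sum_j w j * (\1_A (a j)))%:E.

(** On a Hahn set the Jordan part is the restriction of nu, which is again a
    combination of point masses; the two Hahn sets partition the space. *)
Lemma charge_Rintegral_atomic (D : set T) (f : T -> R) : measurable D ->
    measurable_fun D f ->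
  charge_Rintegral nu D f = \sum_j w j * (\1_D (a j) * f (a j)).
Proof.
move=> mD mf; rewrite /charge_Rintegral.
set PN := hahn_posneg nu; have [[mP _] [mN _] PNT PN0] := PN.
rewrite (@Rintegral_atomic _ _ _ (jordan_pos PN) _ a
  (fun j => w j * \1_(hahn_pos nu) (a j)) set1_measurable) //; last first.
  move=> A mA; apply: etrans (jordan_posE PN A) _.
  rewrite cjordan_posE /crestr0 mem_set // /crestr.
  rewrite nuE; last exact: measurableI.
  by congr EFin; apply: eq_bigr => j _; rewrite indicI /= mulrCA mulrC -mulrA.
rewrite (@Rintegral_atomic _ _ _ (jordan_neg PN) _ a
  (fun j => - (w j * \1_(hahn_neg nu) (a j))) set1_measurable) //; last first.
  move=> A mA; apply: etrans (jordan_negE PN A) _.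
  rewrite cjordan_negE /crestr0 mem_set // /crestr.
  rewrite nuE; last exact: measurableI.
  rewrite -EFinN -sumrN; congr EFin; apply: eq_bigr => j _.
  by rewrite indicI /= mulNr mulrCA mulrC -mulrA.
rewrite -sumrB; apply: eq_bigr => j _.
rewrite mulNr opprK -mulrDl -mulrDr.
suff -> : \1_(hahn_pos nu) (a j) + \1_(hahn_neg nu) (a j) = 1 :> R by rewrite mulr1.
rewrite !indicE -natrD.
have [jP|jP] := boolP (a j \in hahn_pos nu); have [jN|jN] := boolP (a j \in hahn_neg nu) => //.
- have : (hahn_pos nu `&` hahn_neg nu) (a j) by split; exact: set_mem.
  by rewrite PN0.
- have : (hahn_pos nu `|` hahn_neg nu) (a j) by rewrite PNT.
  by case=> /mem_set h; move: jP jN; rewrite h.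
Qed.

End AtomicCharge.

Section BorelKernel.
Local Open Scope classical_set_scope.
Variables (R : realType) (d : nat).
Notation E := (borelRV R d).

Lemma borel_open (A : set 'rV[R]_d) : open A -> measurable (A : set E).
Proof. by move=> oA; apply: sub_sigma_algebra. Qed.

Lemma borel_set1 (x : E) : measurable [set x].
Proof.
rewrite -[X in measurable X]setCK; apply: measurableC; apply: borel_open.
apply: closed_openC; apply: accessible_closed_set1; apply: hausdorff_accessible.
exact: norm_hausdorff.
Qed.

Lemma measurable_coord k : measurable_fun setT (fun y : E => (y : 'rV[R]_d) 0 k).
Proof.
apply: (measurability _ (RGenOInfty.measurableE R)) => /= _ [_ [x ->] <-].
rewrite setTI; apply: borel_open.
apply: open_comp => [z _|]; [exact: coord_continuous | exact: interval_open].
Qed.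

Lemma measurable_sub_coord (x : 'rV[R]_d) k :
  measurable_fun setT (fun y : E => ((y : 'rV[R]_d) - x) 0 k).
Proof.
have -> : (fun y : E => ((y : 'rV[R]_d) - x) 0 k) =
    (fun y : E => (y : 'rV[R]_d) 0 k - x 0 k).
  by apply/funext => y; rewrite !mxE.
by apply: measurable_funB => //; exact: measurable_coord.
Qed.

Lemma measurable_enorm (x : 'rV[R]_d) :
  measurable_fun setT (fun y : E => enorm ((y : 'rV[R]_d) - x)).
Proof.
have -> : (fun y : E => enorm ((y : 'rV[R]_d) - x)) =
    (fun y : E => (\sum_k ((y : 'rV[R]_d) - x) 0 k ^+ 2) `^ 2^-1).
  apply/funext => y; rewrite powR12_sqrt // sumr_ge0 // => k _; exact: sqr_ge0.
apply: (measurableT_comp (measurable_powR _)).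
apply: measurable_sum => k; apply: measurable_funX; exact: measurable_sub_coord.
Qed.

Lemma measurable_riesz_kernel (s : R) (x : 'rV[R]_d) k (D : set E) :
  measurable_fun D (fun y : E => riesz_kernel s ((y : 'rV[R]_d) - x) 0 k).
Proof.
apply: measurable_funTS.
have -> : (fun y : E => riesz_kernel s ((y : 'rV[R]_d) - x) 0 k) =
    (fun y : E => enorm ((y : 'rV[R]_d) - x) `^ (- (s + 1)) * ((y : 'rV[R]_d) - x) 0 k).
  by apply/funext => y; rewrite /riesz_kernel mxE powRN.
apply: measurable_funM; last exact: measurable_sub_coord.
by apply: (measurableT_comp (measurable_powR _)); exact: measurable_enorm.
Qed.

Lemma measurable_exterior (x : 'rV[R]_d) (eps : R) :
  measurable ([set y : 'rV[R]_d | eps < enorm (y - x)] : set E).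
Proof.
have := measurable_enorm x measurableT (measurable_itv `]eps, +oo[%R).
rewrite setTI; congr (measurable _); apply/seteqP; split => y /=.
  by rewrite in_itv /= andbT.
by rewrite in_itv /= andbT.
Qed.

End BorelKernel.

Section ComplexAtoms.
Local Open Scope complex_scope.
Variable R : realType.
Local Notation normc := (@ComplexField.Normc.normc R).

Lemma normc_ge0 (z : R[i]) : 0 <= normc z.
Proof. by case: z => x y; exact: sqrtr_ge0. Qed.

Lemma normc_sum (I : Type) (r : seq I) (P : pred I) (F : I -> R[i]) :
  normc (\sum_(i <- r | P i) F i) <= \sum_(i <- r | P i) normc (F i).
Proof.
elim/big_ind2: _ => //; first by rewrite ComplexField.Normc.normc0.
move=> x1 x2 y1 y2 h1 h2; apply: le_trans (le_normcD _ _) _.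
exact: lerD.
Qed.

Lemma normc_real (x : R) : normc x%:C = `|x|.
Proof. by rewrite /= expr0n /= addr0 sqrtr_sqr. Qed.

Lemma Re_sum (I : Type) (r : seq I) (P : pred I) (F : I -> R[i]) :
  complex.Re (\sum_(i <- r | P i) F i) = \sum_(i <- r | P i) complex.Re (F i).
Proof. by apply: (big_morph (@complex.Re R)) => // -[? ?] [? ?]. Qed.

Lemma Im_sum (I : Type) (r : seq I) (P : pred I) (F : I -> R[i]) :
  complex.Im (\sum_(i <- r | P i) F i) = \sum_(i <- r | P i) complex.Im (F i).
Proof. by apply: (big_morph (@complex.Im R)) => // -[? ?] [? ?]. Qed.

Lemma Re_le_normc (z : R[i]) : `|complex.Re z| <= normc z.
Proof.
case: z => x y; rewrite -sqrtr_sqr ler_wsqrtr // lerDl; exact: sqr_ge0.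
Qed.

Lemma Im_le_normc (z : R[i]) : `|complex.Im z| <= normc z.
Proof.
case: z => x y; rewrite -sqrtr_sqr ler_wsqrtr // lerDr; exact: sqr_ge0.
Qed.

Lemma normc_le (z : R[i]) : normc z <= `|complex.Re z| + `|complex.Im z|.
Proof.
case: z => x y /=.
rewrite -ler_sqr ?nnegrE ?addr_ge0 ?sqrtr_ge0 // sqr_sqrtr ?addr_ge0 ?sqr_ge0 //.
rewrite sqrrD !real_normK ?num_real // addrAC lerDl.
by rewrite mulrn_wge0 // mulr_ge0.
Qed.

End ComplexAtoms.

(** * Total variation and Riesz transform of point masses *)
Section Variation.
Local Open Scope classical_set_scope.
Local Open Scope complex_scope.
Context (disp : measure_display) (T : measurableType disp) (R : realType).
Variables (nu : complex_measure T R) (N : nat) (c : 'I_N -> R[i]) (a : 'I_N -> T).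
Hypothesis set1_measurable : forall x : T, measurable [set x].
Hypothesis nuE : forall A, measurable A ->
  cmval nu A = \sum_j c j * (\1_A (a j) : R)%:C.
Local Notation normc := (@ComplexField.Normc.normc R).
Local Notation r := (first_index a).

Definition merged (j : 'I_N) : R[i] := \sum_(i | r i == j) c i.

Lemma cmval_merged A : measurable A ->
  cmval nu A = \sum_j merged j * (\1_A (a j) : R)%:C.
Proof.
move=> mA; rewrite nuE //.
have -> : \sum_j merged j * (\1_A (a j) : R)%:C =
    \sum_j \sum_(i | r i == j) c i * (\1_A (a j) : R)%:C.
  by apply: eq_bigr => j _; rewrite mulr_suml.
rewrite (sum_fibers r xpredT (fun i j => c i * (\1_A (a j) : R)%:C)) /=.
by apply: eq_bigr => i _; rewrite first_indexK.
Qed.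

Let cmval_atom j : r j == j -> cmval nu [set a j] = merged j.
Proof.
move=> rj; rewrite nuE // /merged [RHS]big_mkcond; apply: eq_bigr => i _.
rewrite (first_index_eqE rj) indicE; case: asboolP => h.
  by rewrite mem_set // mulr1.
by rewrite memNset // mulr0.
Qed.

Let merged_eq0 j : r j != j -> merged j = 0.
Proof.
move=> rj; rewrite /merged big_pred0 // => i; apply/negbTE.
by apply: contra rj => ij; rewrite (first_index_eqE ij); exact/asboolP.
Qed.

Let sum_indic_le1 (F : (set T)^nat) (n : nat) (x : T) : trivIset setT F ->
  \sum_(0 <= k < n) (\1_(F k) x : R) <= 1.
Proof.
move=> tF; rewrite big_mkord.
have [k hk|none] := pickP (fun k : 'I_n => x \in F k); last first.
  by rewrite big1 // => k _; rewrite indicE (none k).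
rewrite (bigD1 k) //= [X in _ + X]big1 ?addr0 => [|l lk].
  by rewrite indicE hk.
rewrite indicE; case: (boolP (x \in F l)) => // hl; case/eqP: lk.
apply: val_inj; apply: (tF l k) => //; exists x; split; exact: set_mem.
Qed.

(** Finiteness of the total variation: otherwise its real value [fine] would be
    0 and would bound nothing. *)
Let cmvariation_le : (cmvariation nu <= (\sum_j normc (c j))%:E)%E.
Proof.
apply: ub_ereal_sup => _ [F [mF tF _] <-].
apply: lime_le; first by apply: is_cvg_nneseries => n _ _; rewrite lee_fin normc_ge0.
apply: nearW => n; rewrite sumEFin lee_fin.
apply: (@le_trans _ _ (\sum_(0 <= k < n) \sum_j normc (c j) * \1_(F k) (a j))).
  apply: ler_sum => k _; rewrite nuE //; apply: le_trans (normc_sum _ _ _) _.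
  apply: ler_sum => j _.
  by rewrite ComplexField.Normc.normcM normc_real ger0_norm // indicE.
rewrite exchange_big; apply: ler_sum => j _ /=.
by rewrite -mulr_sumr ler_piMr ?normc_ge0 //; exact: sum_indic_le1.
Qed.

Let block (k : nat) : set T :=
  if insub k is Some j then (if r j == j then [set a j] else set0) else set0.

Let measurable_block k : measurable (block k).
Proof. by rewrite /block; case: insub => // j; case: ifP. Qed.

Let block_lt k x : block k x -> exists j : 'I_N, [/\ k = j, r j = j & x = a j].
Proof.
rewrite /block; case: insubP => // j _ jk; case: ifP => // /eqP rj ->.
by exists j.
Qed.

(** The singletons of the distinct points, indexed by their canonical indices,
    then at index N the complement, and empty sets elsewhere. *)
Let atom_partition (k : nat) : set T := if k == N then ~` (\bigcup_l block l) else block k.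

Let sum_merged_le : ((\sum_j normc (merged j))%:E <= cmvariation nu)%E.
Proof.
apply: (@le_trans _ _ (\sum_(0 <= k <oo) (normc (cmval nu (atom_partition k)))%:E)%E).
  apply: le_trans (nneseries_lim_ge N _); last first.
    by move=> n _ _; rewrite lee_fin normc_ge0.
  rewrite sumEFin lee_fin big_mkord le_eqVlt; apply/orP; left; apply/eqP.
  apply: eq_bigr => j _; rewrite /atom_partition ltn_eqF // /block valK.
  case: ifPn => rj; first by rewrite cmval_atom.
  rewrite merged_eq0 // nuE // big1 // => i _.
  by rewrite indicE in_set0 mulr0.
apply: ereal_sup_ubound; exists atom_partition => //; split.
- move=> k; rewrite /atom_partition; case: ifP => // _; apply: measurableC.
  exact: bigcup_measurable.
- move=> k l _ _ [x []]; rewrite /atom_partition.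
  case: eqP => [->|_]; case: eqP => [->|_] //.
  + by move=> h1 h2; exfalso; apply: h1; exists l.
  + by move=> h1 h2; exfalso; apply: h2; exists k.
  + move=> /block_lt[i [-> ri ->]] /block_lt[j [-> rj aij]].
    by rewrite -ri -rj; congr (_ _); apply/eqP; rewrite first_index_eq; exact/asboolP.
- apply/seteqP; split => // x _.
  have [[l _ hl]|h] := pselect ((\bigcup_l block l) x).
    exists l => //; rewrite /atom_partition ltn_eqF //.
    by have [j [-> _ _]] := block_lt hl.
  by exists N => //; rewrite /atom_partition eqxx.
Qed.

Lemma sum_normc_merged_le : \sum_j normc (merged j) <= fine (cmvariation nu).
Proof.
have h : cmvariation nu \is a fin_num.
  rewrite ge0_fin_numE; last first.
    by apply: le_trans sum_merged_le; rewrite lee_fin sumr_ge0 // => j _; exact: normc_ge0.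
  by apply: le_lt_trans cmvariation_le _; exact: ltry.
by rewrite -lee_fin fineK.
Qed.

End Variation.

Section RieszAtoms.
Local Open Scope classical_set_scope.
Local Open Scope complex_scope.
Variables (R : realType) (d : nat) (s : R).
Variables (nu : complex_measure (borelRV R d) R).
Variables (N : nat) (c : 'I_N -> R[i]) (a : 'I_N -> 'rV[R]_d).
Hypothesis nuE : forall A : set (borelRV R d), measurable A ->
  cmval nu A = \sum_j c j * (\1_A (a j) : R)%:C.

Let ReE (A : set (borelRV R d)) : measurable A ->
  cmRe nu A = (\sum_j complex.Re (c j) * \1_A (a j))%:E.
Proof.
move=> mA; have fA : cmRe nu A \is a fin_num by exact: fin_num_measure.
rewrite -(fineK fA); congr EFin.
have := congr1 (@complex.Re R) (nuE mA); rewrite Re_sum /= => ->.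
by apply: eq_bigr => j _; case: (c j) => x y /=; rewrite mulr0 subr0.
Qed.

Let ImE (A : set (borelRV R d)) : measurable A ->
  cmIm nu A = (\sum_j complex.Im (c j) * \1_A (a j))%:E.
Proof.
move=> mA; have fA : cmIm nu A \is a fin_num by exact: fin_num_measure.
rewrite -(fineK fA); congr EFin.
have := congr1 (@complex.Im R) (nuE mA); rewrite Im_sum /= => ->.
by apply: eq_bigr => j _; case: (c j) => x y /=; rewrite mulr0 add0r.
Qed.

Let riesz_sumE (v : 'I_N -> R) eps x k :
  \sum_j v j * (\1_[set y : 'rV[R]_d | eps < enorm (y - x)] (a j) *
    riesz_kernel s (a j - x) 0 k) = riesz_sum s v a k eps x.
Proof.
rewrite /riesz_sum [RHS]big_mkcond; apply: eq_bigr => j _.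
rewrite indicE; case: ifPn => h; first by rewrite mem_set // mul1r.
by rewrite memNset ?mul0r ?mulr0 //=; exact/negP.
Qed.

Lemma riesz_transform_atoms eps x k : riesz_transform s nu eps x 0 k =
  riesz_sum s (fun j => complex.Re (c j)) a k eps x +i*
  riesz_sum s (fun j => complex.Im (c j)) a k eps x.
Proof.
rewrite mxE /cmintegral -!riesz_sumE.
rewrite (charge_Rintegral_atomic (@borel_set1 R d) ReE); first last.
- exact: measurable_riesz_kernel.
- exact: measurable_exterior.
rewrite (charge_Rintegral_atomic (@borel_set1 R d) ImE) //.
- exact: measurable_exterior.
- exact: measurable_riesz_kernel.
Qed.

End RieszAtoms.

(** * Scaling and covering *)
Section Scaling.
Variables (R : realType) (d : nat) (s : R) (N : nat).

Lemma riesz_kernelZ (t : R) (z : 'rV[R]_d) k : 0 < t ->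
  riesz_kernel s (t *: z) 0 k = t `^ (- s) * riesz_kernel s z 0 k.
Proof.
move=> t0; rewrite !mxE enormZ gtr0_norm // powRM ?enorm_ge0 ?(ltW t0) // invfM.
have -> : (t `^ (s + 1))^-1 = t `^ (- s) / t.
  rewrite -powRN opprD powRD; last by rewrite (gt_eqF t0) implybT.
  by rewrite powR_inv1 // ltW.
by move: (_ `^ _)^-1 => e; field; rewrite gt_eqF.
Qed.

Lemma riesz_sum_dilate (t : R) (v : 'I_N -> R) (a : 'I_N -> 'rV[R]_d) k eps x : 0 < t ->
  riesz_sum s v (fun j => t *: a j) k (t * eps) (t *: x) =
  t `^ (- s) * riesz_sum s v a k eps x.
Proof.
move=> t0; rewrite /riesz_sum mulr_sumr; apply: eq_big => [j|j _].
  by rewrite -scalerBr enormZ gtr0_norm // ltr_pM2l.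
by rewrite -scalerBr riesz_kernelZ // mulrCA.
Qed.

Lemma riesz_sumZ (c : R) (v : 'I_N -> R) (a : 'I_N -> 'rV[R]_d) k eps x :
  riesz_sum s (fun j => c * v j) a k eps x = c * riesz_sum s v a k eps x.
Proof. by rewrite /riesz_sum mulr_sumr; apply: eq_bigr => j _; rewrite mulrA. Qed.

End Scaling.

Section Content.
Local Open Scope classical_set_scope.
Variables (R : realType) (d : nat) (h : R -> R).
Hypothesis hd : (1 <= d)%N.
Hypothesis hh : measuring_function d h.

Lemma measuring_dilate (t delta : R) : 1 <= t -> 0 < delta ->
  h (t * delta) <= t ^+ d * h delta.
Proof.
move=> t1 d0; have t0 : 0 < t by exact: lt_le_trans t1.
have td0 : 0 < t * delta by rewrite mulr_gt0.
have := @mf_ratio _ _ _ hh delta (t * delta) d0 _.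
rewrite ler_peMl ?(ltW d0) // => /(_ isT).
rewrite ler_pdivrMr ?exprn_gt0 // => /le_trans; apply.
rewrite exprMn le_eqVlt; apply/orP; left; apply/eqP; field.
by rewrite expf_neq0 // gt_eqF.
Qed.

Lemma content_le_card (G : set 'rV[R]_d) (r : R) (S : seq 'rV[R]_d) : 0 < r ->
    (forall x, G x -> exists2 c, c \in S & enorm (x - c) <= r) ->
  (hausdorff_content h G <= ((size S)%:R * h r)%:E)%E.
Proof.
move=> r0 cover; apply: ereal_inf_lbound.
exists `I_(size S), (fun j => nth 0 S j), (fun=> r); split => //.
  move=> x /cover[c cS xc]; exists (index c S); first by rewrite /= index_mem.
  by rewrite /ecball /= nth_index.
rewrite esum_fset //; last first.
  by move=> j _; rewrite lee_fin (mf_ge0 hh) // ltW.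
rewrite -fsbig_ord sumEFin; congr EFin.
by rewrite sumr_const card_ord mulr_natl.
Qed.

Lemma content_set0 : (hausdorff_content h (set0 : set 'rV[R]_d) <= 0)%E.
Proof.
have := @content_le_card set0 1 [::] ltr01; rewrite mul0r; apply.
by [].
Qed.

(** A bound for the finite lists of cells met by G bounds all of them; the
    centres are the lattice points of the cells. *)
Lemma content_le_cells (G : set 'rV[R]_d) (delta B : R) : 0 < delta ->
    (forall S : seq 'rV[int]_d, uniq S ->
       (forall q, q \in S -> exists2 x, G x & floor_vec (delta^-1 *: x) = q) ->
       (size S)%:R <= B) ->
  (hausdorff_content h G <= (B * d%:R ^+ d * h delta)%:E)%E.
Proof.
move=> d0 SB.
pose Q : set 'rV[int]_d := [set q | exists2 x, G x & floor_vec (delta^-1 *: x) = q].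
have finQ : finite_set Q.
  apply: contrapT => /infinite_set_fset H.
  have B0 : 0 <= B by exact: (SB [::]).
  have [X XQ] := H (Num.bound B).
  have := SB (finmap.enum_fset X) (finmap.fset_uniq X) (fun q qX => XQ q qX).
  move=> hX; rewrite leqNgt => /negP; apply.
  by rewrite -(ltr_nat R); apply: le_lt_trans hX _; exact: archi_boundP.
have [S0 QS0] := (finite_seqP Q).1 finQ.
pose S := undup S0.
have SQ q : q \in S -> Q q by rewrite mem_undup QS0.
have sS : (size S)%:R <= B by apply: SB => //; exact: undup_uniq.
pose centres := map (fun q => delta *: int_vec R q) S.
have dd0 : 0 < d%:R * delta :> R by rewrite mulr_gt0 // ltr0n.
apply: (@le_trans _ _ ((size centres)%:R * h (d%:R * delta))%:E).
  apply: content_le_card => // x Gx.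
  exists (delta *: int_vec R (floor_vec (delta^-1 *: x))).
    apply: map_f; rewrite mem_undup.
    have : Q (floor_vec (delta^-1 *: x)) by exists x.
    by rewrite QS0.
  rewrite -[x in x - _](scalerKV (lt0r_neq0 d0)) -scalerBr enormZ gtr0_norm //.
  by rewrite mulrC ler_wpM2r ?(ltW d0) // enorm_floor_vec.
rewrite size_map lee_fin -mulrA; apply: ler_pM => //.
  by rewrite (mf_ge0 hh) // ltW.
by apply: measuring_dilate => //; rewrite ler1n.
Qed.

End Content.

Section BadSet.
Local Open Scope classical_set_scope.
Variables (R : realType) (d : nat) (s : R).

Definition part (b : bool) (z : R[i]) : R := if b then complex.Re z else complex.Im z.

Lemma cnorm_le (z : 'rV[R[i]]_d) : cnorm z <= \sum_k \sum_b `|part b (z 0 k)|.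
Proof.
have := enorm_le_sum (\row_k ComplexField.Normc.normc (z 0 k)).
rewrite /enorm; under eq_bigr do rewrite mxE.
move=> /le_trans; apply; apply: ler_sum => k _.
by rewrite mxE ger0_norm ?normc_ge0 // big_bool /=; exact: normc_le.
Qed.

(** The norm of a vector of C^d is at most the sum of the moduli of its 2d real
    components, so one of these exceeds P / (2d). *)
Lemma bad_set_component (nu : complex_measure (borelRV R d) R) (N : nat)
    (c : 'I_N -> R[i]) (a : 'I_N -> 'rV[R]_d) (P : R) x :
    (forall A : set (borelRV R d), measurable A ->
       cmval nu A = \sum_j c j * ((\1_A (a j) : R)%:C)%C) ->
    0 <= P -> riesz_bad_set s nu P x ->
  exists k b eps, 0 < eps /\
    P < d.*2%:R * `|riesz_sum s (fun j => part b (c j)) a k eps x|.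
Proof.
move=> nuE P_ge0 /ereal_sup_gt[_ [eps /= eps0 <-]]; rewrite lte_fin => Pc.
apply: contrapT => none; move: Pc; apply/negP; rewrite -leNgt.
apply: le_trans (cnorm_le _) _.
have le1 k b : d.*2%:R * `|part b (riesz_transform s nu eps x 0 k)| <= P.
  rewrite leNgt; apply/negP => h; apply: none; exists k, b, eps; split => //.
  by move: h; rewrite (riesz_transform_atoms s nuE); case: b.
have d2 : d.*2%:R = d%:R * 2 :> R by rewrite -muln2 natrM.
have [j _|noj] := pickP (fun _ : 'I_d => true); last first.
  by rewrite big_pred0 // P_ge0.
have d0 : 0 < d%:R :> R by rewrite ltr0n; case: (d) j => // -[].
apply: (@le_trans _ _ (\sum_(k < d) \sum_(b : bool) P / d.*2%:R)).
  apply: ler_sum => k _; apply: ler_sum => b _.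
  by rewrite ler_pdivlMr ?d2 ?mulr_gt0 // mulrC -d2.
rewrite !sumr_const card_ord card_bool d2 le_eqVlt; apply/orP; left; apply/eqP.
by rewrite -[_ *+ d]mulr_natr -[_ *+ 2]mulr_natr; field; rewrite gt_eqF.
Qed.

End BadSet.

Theorem theorem4p4 (R : realType) (d : nat) (s : R) (hd : (1 <= d)%N)
    (hs : d%:R <= s) :
  exists C : R, 0 < C /\
    forall (h : R -> R) (N : nat) (P : R)
      (nu : complex_measure (borelRV R d) R),
      measuring_function d h -> (2 <= N)%N -> 0 < P ->
      dirac_combination nu N ->
      (hausdorff_content h (riesz_bad_set s nu P) <=
        (C * N%:R *
          h ((fine (cmvariation nu) / (P * N%:R)) `^ (s^-1)))%:E)%E.
Proof.
have [C0 C0_ge0 HC] := card_bad_cells hs.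
pose C1 : R := d.*2%:R * (C0 * (1 + d.*2%:R)).
have C1_ge0 : 0 <= C1 by rewrite !mulr_ge0 // addr_ge0.
have s0 : 0 < s by apply: lt_le_trans hs; rewrite ltr0n.
exists (C1 * d%:R ^+ d + 1); split.
  by rewrite ltr_wpDl // mulr_ge0 ?exprn_ge0.
move=> h N P nu hh N2 P0 [c0 [a nuE0]].
have N0 : 0 < N%:R :> R by rewrite ltr0n; exact: leq_trans N2.
have nuE1 (A : set (borelRV R d)) : measurable A ->
    cmval nu A = \sum_j c0 j * ((\1_A (a j) : R)%:C)%C.
  by move=> mA; rewrite nuE0.
have nuE := cmval_merged nuE1.
have := sum_normc_merged_le (@borel_set1 R d) nuE1.
set c := merged c0 a in nuE *; set V := fine _ => cV.
have V0 : 0 <= V by apply: le_trans cV; rewrite sumr_ge0 // => j _; exact: normc_ge0.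
have partV b : \sum_j `|part b (c j)| <= V.
  apply: le_trans cV; apply: ler_sum => j _.
  by case: b; [exact: Re_le_normc | exact: Im_le_normc].
pose delta := (V / (P * N%:R)) `^ s^-1; rewrite -/delta.
have hdelta : 0 <= h delta by apply: (mf_ge0 hh); exact: powR_ge0.
(* delta = 0 when all the coefficients vanish, and the bad set is empty *)
have [VE|Vpos] := eqVneq V 0.
  rewrite (_ : riesz_bad_set s nu P = set0).
    apply: le_trans (content_set0 hh) _.
    by rewrite lee_fin !mulr_ge0 // addr_ge0 // mulr_ge0 ?exprn_ge0.
  apply/seteqP; split => // x /(bad_set_component nuE (ltW P0))[k [b [eps [_]]]].
  rewrite (_ : riesz_sum _ _ _ _ _ _ = 0) ?normr0 ?mulr0 ?ltNge ?(ltW P0) //.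
  rewrite /riesz_sum big1 // => j _; suff -> : part b (c j) = 0 by rewrite mul0r.
  apply/normr0_eq0/le_anti; rewrite normr_ge0 andbT -VE.
  by apply: le_trans (partV b); rewrite (bigD1 j) //= lerDl sumr_ge0.
have {}Vpos : 0 < V by rewrite lt0r Vpos.
have delta0 : 0 < delta by rewrite powR_gt0 // divr_gt0 // mulr_gt0.
have deltas : delta `^ s = V / (P * N%:R).
  by rewrite /delta -powRrM mulVf ?gt_eqF // powRr1 // divr_ge0 // mulr_ge0 ?ltW.
apply: le_trans (content_le_cells hd hh (B := C1 * N%:R) delta0 _) _; last first.
  rewrite lee_fin ler_wpM2r //.
  have : 0 <= C1 * d%:R ^+ d by rewrite mulr_ge0 ?exprn_ge0.
  by move: (d%:R ^+ d) => e he; nra.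
move=> S S_uniq S_bad.
(* kappa delta^s = 2d / P, so that components above P / (2d) exceed 1 *)
pose kappa : R := d.*2%:R * N%:R / V.
have kappa0 : 0 <= kappa by rewrite divr_ge0 // mulr_ge0.
pose v b j := kappa * part b (c j).
pose a' j := delta^-1 *: a j.
pose bad (kb : 'I_d * bool) q := `[< exists2 x, floor_vec x = q &
  exists2 eps, 0 < eps & 1 < `|riesz_sum s (v kb.2) a' kb.1 eps x| >].
have each kb : (size [seq q <- S | bad kb q])%:R <= C0 * ((1 + d.*2%:R) * N%:R).
  apply: le_trans (HC N (v kb.2) a' kb.1 [seq q <- S | bad kb q] _ _) _.
  - exact: filter_uniq.
  - by move=> q; rewrite mem_filter => /andP[/asboolP].
  - rewrite ler_wpM2l // mulrDl mul1r lerD2l.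
    have -> : \sum_j `|v kb.2 j| = kappa * \sum_j `|part kb.2 (c j)|.
      by rewrite mulr_sumr; apply: eq_bigr => j _; rewrite normrM ger0_norm.
    apply: le_trans (ler_wpM2l kappa0 (partV _)) _.
    by rewrite /kappa divfK ?gt_eqF.
have cover q : q \in S -> (1 <= \sum_kb bad kb q)%N.
  move=> /S_bad[x xbad xq].
  have [k [b [eps [eps0 big]]]] := bad_set_component nuE (ltW P0) xbad.
  rewrite (bigD1 (k, b)) //=.
  suff -> : bad (k, b) q by [].
  apply/asboolP; exists (delta^-1 *: x) => //.
  exists (delta^-1 * eps); first by rewrite mulr_gt0 ?invr_gt0.
  rewrite riesz_sumZ riesz_sum_dilate ?invr_gt0 // normrM ger0_norm //.
  have -> : delta^-1 `^ (- s) = V / (P * N%:R).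
    by rewrite -powR_inv1 ?(ltW delta0) // -powRrM mulrNN mul1r.
  rewrite normrM ger0_norm ?divr_ge0 ?mulr_ge0 ?(ltW P0) //= mulrA.
  have -> : kappa * (V / (P * N%:R)) = d.*2%:R / P.
    by rewrite /kappa; field; rewrite !gt_eqF.
  by rewrite mulrAC ltr_pdivlMr // mul1r.
have sizeS : (size S <= \sum_kb size [seq q <- S | bad kb q])%N.
  under eq_bigr => kb _ do rewrite size_filter -sum1_count big_mkcond.
  rewrite exchange_big /= -sum1_size big_seq [X in (_ <= X)%N]big_seq.
  apply: leq_sum => q /cover; rewrite (eq_bigr (fun kb => if bad kb q then 1 else 0)%N) //.
apply: (@le_trans _ _ (\sum_(kb : 'I_d * bool) C0 * ((1 + d.*2%:R) * N%:R))).
  apply: (@le_trans _ _ (\sum_kb size [seq q <- S | bad kb q])%N%:R); first by rewrite ler_nat.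
  by rewrite natr_sum; apply: ler_sum.
by rewrite sumr_const card_prod card_ord card_bool muln2 -[leLHS]mulr_natl /C1 -!mulrA lexx.
Qed.
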